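(* Let $X$ be a set, let $k$ be a kernel on $X$ and let $s$ be a normalized complete Nevanlinna--Pick kernel on $X$ such that $k/s \ge 0$. Let $\mathcal{E}$ be a Hilbert space, let $\mathcal{N} \subset \mathcal{M} \subset \mathcal{H}_k \otimes \mathcal{E}$ be two non-zero closed subspaces and let $\mathcal{F}$ be a Hilbert space. If $\Phi \in \operatorname{Mult}(\mathcal{H}_s \otimes \mathcal{F}, \mathcal{H}_k \otimes \mathcal{E})$ is a partially isometric multiplier with $\mathcal{M} = \Phi \cdot (\mathcal{H}_s \otimes \mathcal{F})$, and if $\mathcal{N}$ is $\operatorname{Mult}(\mathcal{H}_s)$-invariant, then there exist a Hilbert space $\mathcal{G}$ and a partially isometric multiplier $\Gamma \in \operatorname{Mult}(\mathcal{H}_s \otimes \mathcal{G}, \mathcal{H}_s \otimes \mathcal{F})$ such that $\Phi \Gamma \in \operatorname{Mult}(\mathcal{H}_s \otimes \mathcal{G}, \mathcal{H}_k \otimes \mathcal{E})$ is a partially isometric multiplier and $\mathcal{N} = (\Phi \Gamma) \cdot (\mathcal{H}_s \otimes \mathcal{G})$.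
   Context: All Hilbert spaces are complex. A kernel on a set $X$ is a positive semi-definite function $k : X \times X \to \mathbb{C}$, i.e. the matrix $[k(x_i,x_j)]$ is positive semi-definite for every finite subset $\{x_1,\dots,x_n\} \subset X$; this is written $k \ge 0$. $\mathcal{H}_k$ denotes the reproducing kernel Hilbert space on $X$ with kernel $k$, so $\langle f, k(\cdot,x)\rangle = f(x)$ for $f \in \mathcal{H}_k$, $x \in X$. $\operatorname{Mult}(\mathcal{H}_k)$ is the algebra of functions $\varphi : X \to \mathbb{C}$ with $\varphi \mathcal{H}_k \subset \mathcal{H}_k$, and $M_\varphi$ is the corresponding multiplication operator. A kernel $s$ is normalized if there is $x_0 \in X$ with $s(x,x_0) = 1$ for all $x \in X$. A normalized kernel $s$ is a complete Nevanlinna--Pick kernel if and only if $s$ is non-vanishing and $1 - 1/s \ge 0$ (this may be taken as the definition). Here $1/s$ and $k/s$ denote pointwise quotients on $X \times X$. For a Hilbert space $\mathcal{E}$, elements of $\mathcal{H}_k \otimes \mathcal{E}$ are regarded as $\mathcal{E}$-valued functions on $X$. For kernels $\ell, k$ on $X$ and Hilbert spaces $\mathcal{F}, \mathcal{E}$, $\operatorname{Mult}(\mathcal{H}_\ell \otimes \mathcal{F}, \mathcal{H}_k \otimes \mathcal{E})$ is the space of functions $\Phi : X \to \mathcal{B}(\mathcal{F},\mathcal{E})$ that multiply $\mathcal{H}_\ell \otimes \mathcal{F}$ into $\mathcal{H}_k \otimes \mathcal{E}$ (pointwise: $(\Phi f)(x) = \Phi(x) f(x)$). Such $\Phi$ is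 called contractive (respectively partially isometric) if the multiplication operator $M_\Phi : \mathcal{H}_\ell \otimes \mathcal{F} \to \mathcal{H}_k \otimes \mathcal{E}$ is contractive (respectively a partial isometry). $\Phi \cdot (\mathcal{H}_\ell \otimes \mathcal{F})$ denotes the range of $M_\Phi$. Products of operator-valued functions such as $\Phi\Gamma$ are pointwise. If $k/s \ge 0$, then $\operatorname{Mult}(\mathcal{H}_s) \subset \operatorname{Mult}(\mathcal{H}_k)$ contractively; a subspace $\mathcal{N} \subset \mathcal{H}_k \otimes \mathcal{E}$ is $\operatorname{Mult}(\mathcal{H}_s)$-invariant if $(M_\varphi \otimes I)\mathcal{N} \subset \mathcal{N}$ for all $\varphi \in \operatorname{Mult}(\mathcal{H}_s)$. *)

(* Defs.v *)
From HB Require Import structures.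
From mathcomp Require Import all_boot all_order all_algebra sesquilinear.
From mathcomp Require Import complex.
From mathcomp Require Import boolp classical_sets reals topology normedtype.

Set Implicit Arguments.
Unset Strict Implicit.
Unset Printing Implicit Defensive.
Import Order.TTheory GRing.Theory Num.Theory.

Local Open Scope classical_set_scope.
Local Open Scope ring_scope.

(** The field of complex numbers is [R[i]], with [R : realType].  In [R[i]],
    [0 <= z] means that [z] is real and nonnegative. *)

HB.mixin Record CompleteNormedModule_isHilbert (R : realType) H
    of CompleteNormedModule R[i] H := {
  (* [{dot _ for conj}] is linear in the first variable and conjugate-linear
     in the second *)
  inner : {dot H for (@Num.conj R[i])} ;
  sqr_normE : forall u : H, `|u| ^+ 2 = inner u u
}.

#[short(type="hilbertType")]
HB.structure Definition Hilbert (R : realType) :=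
  {H of CompleteNormedModule R[i] H & CompleteNormedModule_isHilbert R H}.

Section Operators.
Variables (R : realType) (H K : hilbertType R).

Definition bounded_operator (T : H -> K) : Prop := linear T /\ continuous T.

(* [T] is isometric on the orthogonal complement of its kernel *)
Definition partial_isometry (T : H -> K) : Prop :=
  bounded_operator T /\
  forall f : H, (forall g, T g = 0 -> inner f g = 0) -> `|T f| = `|f|.

Definition closed_subspace (N : set H) : Prop :=
  submod_closed (fun u => u \in N) /\ closed N.

End Operators.

Section Kernels.
Variables (R : realType) (X : Type).

Definition kernel (k : X -> X -> R[i]) : Prop :=
  forall (n : nat) (x : 'I_n -> X) (c : 'I_n -> R[i]),
    0 <= \sum_(i < n) \sum_(j < n) (c i)^* * k (x i) (x j) * c j.

Definition normalized (s : X -> X -> R[i]) : Prop :=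
  exists x0, forall x, s x x0 = 1.

Definition complete_NP (s : X -> X -> R[i]) : Prop :=
  [/\ kernel s, normalized s, forall x y, s x y != 0
    & kernel (fun x y => 1 - (s x y)^-1)].

(** [rkhs k] is the type of presentations of the reproducing kernel Hilbert
    space with kernel [k]: a Hilbert space, embedded by [rkhs_fun] in the
    functions on [X], containing the functions [k(., y)], which reproduce the
    values.  Any two are identified by the unique unitary that commutes with
    [rkhs_fun]. *)
Record rkhs (k : X -> X -> R[i]) := Rkhs {
  rkhs_space :> hilbertType R ;
  rkhs_fun : rkhs_space -> X -> R[i] ;
  rkhs_fun_inj : forall f g, rkhs_fun f =1 rkhs_fun g -> f = g ;
  rkhs_kernel : X -> rkhs_space ;
  rkhs_kernelE : forall x y, rkhs_fun (rkhs_kernel y) x = k x y ;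
  rkhs_reproducing : forall f x, inner f (rkhs_kernel x) = rkhs_fun f x
}.

(* [Mult(H_k)] *)
Definition Mult (k : X -> X -> R[i]) (Hk : rkhs k) : set (X -> R[i]) :=
  [set phi | forall f : Hk, exists g : Hk,
    forall x, rkhs_fun g x = phi x * rkhs_fun f x].

End Kernels.

(** Presentations of the Hilbert space tensor product: the completion of the
    algebraic tensor product for
    [<h (x) e, h' (x) e'> = <h, h'> <e, e'>]. *)
Record hilbert_tensor (R : realType) (H E : hilbertType R) := HilbertTensor {
  tensor_space :> hilbertType R ;
  tens : {bilinear H -> E -> tensor_space} ;
  inner_tens : forall h e h' e',
    inner (tens h e) (tens h' e') = inner h h' * inner e e' ;
  tens_dense :
    dense [set t | exists s : seq (H * E), t = \sum_(p <- s) tens p.1 p.2]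
}.

(** [H_k (x) E] together with the identification of its elements with
    [E]-valued functions: [tensor_fun] is the unique linear, pointwise
    continuous extension of [(f (x) e)(x) = f(x) e]. *)
Record rkhs_tensor (R : realType) (X : Type) (k : X -> X -> R[i])
    (Hk : rkhs k) (E : hilbertType R) := RkhsTensor {
  rkhs_tensor_space :> hilbert_tensor Hk E ;
  tensor_fun : rkhs_tensor_space -> X -> E ;
  tensor_fun_bounded : forall x, bounded_operator (tensor_fun ^~ x) ;
  tensor_fun_tens : forall (f : Hk) (e : E) x,
    tensor_fun (tens rkhs_tensor_space f e) x = rkhs_fun f x *: e
}.

Section Multipliers.
Variables (R : realType) (X : Type) (l k : X -> X -> R[i]).
Variables (Hl : rkhs l) (Hk : rkhs k) (F E : hilbertType R).
Variables (HlF : rkhs_tensor Hl F) (HkE : rkhs_tensor Hk E).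

(* [Mult(H_l (x) F, H_k (x) E)] *)
Definition multiplier (Phi : X -> F -> E) : Prop :=
  (forall x, bounded_operator (Phi x)) /\
  forall f : HlF, exists g : HkE,
    forall x, tensor_fun g x = Phi x (tensor_fun f x).

(* [M_Phi]; the default value 0 is not used when [Phi] is a multiplier, and
   [g] is unique because [tensor_fun] is injective *)
Definition mulop (Phi : X -> F -> E) (f : HlF) : HkE :=
  xget 0 [set g | forall x, tensor_fun g x = Phi x (tensor_fun f x)].

Definition partially_isometric_multiplier (Phi : X -> F -> E) : Prop :=
  multiplier Phi /\ partial_isometry (mulop Phi).

End Multipliers.

Arguments multiplier {R X l k Hl Hk F E} HlF HkE Phi.
Arguments mulop {R X l k Hl Hk F E} HlF HkE Phi f.
Arguments partially_isometric_multiplier {R X l k Hl Hk F E} HlF HkE Phi.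

(* [M_phi (x) I] is the multiplication by [phi] of [E]-valued functions *)
Lemma ampliationE (R : realType) (X : Type) (k : X -> X -> R[i])
    (Hk : rkhs k) (E : hilbertType R) (HkE : rkhs_tensor Hk E)
    (phi : X -> R[i]) (T : HkE -> HkE) :
    Mult Hk phi -> bounded_operator T ->
    (forall (f g : Hk) (e : E),
      (forall x, rkhs_fun g x = phi x * rkhs_fun f x) ->
      T (tens HkE f e) = tens HkE g e) ->
  forall (t : HkE) x, tensor_fun (T t) x = phi x *: tensor_fun t x.
Proof.
move=> phik [Tlin Tcont] Ttens t x.
have [xlin xcont] := @tensor_fun_bounded _ _ _ _ _ HkE x.
pose D u := tensor_fun (T u) x - phi x *: tensor_fun u x.
have Dlin : linear D.
  move=> a u v; rewrite /D Tlin !xlin scalerDr scalerA mulrC -scalerA.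
  by rewrite opprD addrACA scalerBr.
have Dcont : continuous D.
  move=> u; apply: cvgB; last by apply: cvgZr; exact: xcont.
  exact: (cvg_comp _ _ (Tcont u) (xcont (T u))).
suff D0 : D t = 0 by apply/eqP; rewrite -subr_eq0 -/(D t) D0.
apply: contrapT => Dt.
have Dopen : open (D @^-1` [set~ 0]).
  apply: open_comp => [? _|]; first exact: Dcont.
  exact/closed_openC/accessible_closed_set1/hausdorff_accessible.
have Dneq0 : D @^-1` [set~ 0] !=set0 by exists t.
have [u [Du [s us]]] := @tens_dense _ _ _ HkE _ Dneq0 Dopen.
apply: Du; rewrite us; elim: s {us} => [|[f e] s IHs].
  by rewrite big_nil -(subrr t) -scaleN1r addrC Dlin scaleN1r addNr.
have [g fg] := phik f.
rewrite big_cons -[tens _ _ _]scale1r Dlin IHs addr0 scale1r /D /=.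
by rewrite (Ttens f g) // !tensor_fun_tens fg scalerA subrr.
Qed.

Definition Mult_invariant (R : realType) (X : Type) (s k : X -> X -> R[i])
    (Hs : rkhs s) (Hk : rkhs k) (E : hilbertType R) (HkE : rkhs_tensor Hk E)
    (N : set HkE) : Prop :=
  forall phi, Mult Hs phi ->
    mulop HkE HkE (fun x (e : E) => phi x *: e) @` N `<=` N.

(* Main.v *)
From HB Require Import structures.
Require Import Defs.
From mathcomp Require Import all_boot all_order all_algebra sesquilinear.
From mathcomp Require Import complex.
From mathcomp Require Import boolp classical_sets functions reals topology normedtype.
From mathcomp Require Import ring lra.
Set Implicit Arguments.
Unset Strict Implicit.
Unset Printing Implicit Defensive.
Import Order.TTheory GRing.Theory Num.Theory.
Import numFieldNormedType.Exports.
Local Open Scope classical_set_scope.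
Local Open Scope ring_scope.

(** Write [T] for the operator [M_Phi] and put [L = T^-1(N)].  Multiplications
    by scalar functions commute with [T], so [L] is a closed
    [Mult(H_s)]-invariant subspace of [H_s (x) F], and it contains [ker T].  A
    Beurling-Lax theorem ([invariant_subspace_multiplier]) provides a
    partially isometric multiplier [Gamma] with range [L]; let [U] be its
    multiplication operator and [U'] the adjoint, so that [U U'] is the
    identity on [L].  The range of [T U] is [T(L)], which is [N] because [N]
    lies in the range of [T].  If [h] is orthogonal to [ker (T U)], it is
    orthogonal to [ker U], so [|U h| = |h|]; and for [g] in [ker T] one has
    [T U U' g = T g = 0], so [<U h, g> = <h, U' g> = 0], which shows that
    [U h] is orthogonal to [ker T] and that [|T U h| = |U h|].  Thus [T U] is a
    partial isometry.

    For the Beurling-Lax theorem, let [P] be the projection onto [L] and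
    consider the operator-valued kernel [K] given by
    [<K(x,y) g, f> = <P (s_y (x) g), s_x (x) f>].  The point is that [K/s] is
    positive semi-definite ([invariant_kernel_div_psd]).  Write
    [1 - 1/s(x,y) = <b_y, b_x>] with vectors [b_x] of a Hilbert space [B].
    Since [s(x,y) (1 - <b_y, b_x>) = 1], multiplication by the row [b] is a
    contraction from [(H_s (x) F) (x) B] to [H_s (x) F] ([row_operator]).  Its
    components [1 - 1/s(.,y)] are multipliers of [H_s], so it maps [L (x) B] to
    [L].  For [t = sum_i t_i] with [t_i = s_{x_i} (x) f_i], let
    [w = sum_i P t_i (x) b_{x_i}] and let [z] in [L] be the image of [w].  Then
    [|w|^2 = <z, t> = <z, P t> <= |w| |P t|], and [|P t|^2 - |w|^2] is the value
    at [(f_i)] of the quadratic form of [K/s].  Factoring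
    [K(x,y)/s(x,y) = Gamma(x) Gamma(y)'], with ['] for adjoints, the vectors
    [s_x (x) Gamma(x)' f] have the same Gram matrix as the vectors
    [P (s_x (x) f)], whose closed span is [L].  The partial isometry that maps
    the former to the latter ([gram_partial_isometry]) is [M_Gamma].

    Two facts about Hilbert spaces carry all this.  Bounded moment problems are
    solvable ([moment_problem]), which yields projections, adjoints and partial
    isometries.  Every positive semi-definite kernel is a Gram matrix
    ([gram_exists]), which yields [B], the auxiliary space [G] and, with the
    Schur product theorem, the tensor products. *)

(** * Real-valued norms of complex normed spaces *)

Section RealNorm.
Variable R : realType.
Local Notation C := R[i].

(** The norm of a normed module over [R[i]] takes its values in [R[i]], which is
    only partially ordered; estimates are made on its real part. *)
Definition nm (V : normedZmodType C) (v : V) : R := complex.Re `|v|.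

Lemma le_of_sqr (x m : R) : 0 <= x -> 0 <= m -> x ^+ 2 <= m * x -> x <= m.
Proof.
rewrite le_eqVlt => /predU1P[<-//|x0] _.
by rewrite expr2 ler_pM2r.
Qed.

Lemma ge0_Re (z : C) : 0 <= z -> z = (complex.Re z)%:C%C.
Proof. by case: z => a b; rewrite lecE /= => /andP[/eqP-> _]. Qed.

Lemma Re_ge0 (z : C) : 0 <= z -> 0 <= complex.Re z.
Proof. by case: z => a b; rewrite lecE /= => /andP[]. Qed.

Lemma ReD (a b : C) : complex.Re (a + b) = complex.Re a + complex.Re b.
Proof. by case: a; case: b. Qed.

Lemma ReN (a : C) : complex.Re (- a) = - complex.Re a.
Proof. by case: a. Qed.

Lemma ReJ (a : C) : complex.Re a^* = complex.Re a.
Proof. by case: a. Qed.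

Lemma ReCM (r : R) (a : C) : complex.Re (r%:C%C * a) = r * complex.Re a.
Proof. by case: a => a b /=; rewrite mul0r subr0. Qed.

Lemma Re_le (a b : C) : a <= b -> complex.Re a <= complex.Re b.
Proof. by rewrite lecE => /andP[]. Qed.

Lemma conjCR (r : R) : (r%:C%C)^* = r%:C%C :> C.
Proof. by rewrite /Num.conj /=; congr (_ +i* _)%C; rewrite oppr0. Qed.

Section Zmod.
Variable V : normedZmodType C.
Implicit Types u v : V.

Lemma nmE v : `|v| = (nm v)%:C%C.
Proof. exact/ge0_Re/normr_ge0. Qed.

Lemma nm_ge0 v : 0 <= nm v.
Proof. exact/Re_ge0/normr_ge0. Qed.

Lemma nmD u v : nm (u + v) <= nm u + nm v.
Proof. by rewrite -ReD; apply/Re_le/ler_normD. Qed.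

Lemma nmN v : nm (- v) = nm v.
Proof. by rewrite /nm normrN. Qed.

Lemma nm_distC u v : nm (u - v) = nm (v - u).
Proof. by rewrite -nmN opprB. Qed.

Lemma nmB u v : nm (u - v) <= nm u + nm v.
Proof. by rewrite -(nmN v) nmD. Qed.

Lemma nm_dist w u v : nm (u - v) <= nm (u - w) + nm (w - v).
Proof. by rewrite -(subrKA w u) nmD. Qed.

Lemma nm0 : nm (0 : V) = 0.
Proof. by rewrite /nm normr0. Qed.

Lemma nm_eq0 v : nm v = 0 -> v = 0.
Proof. by move=> v0; apply/eqP; rewrite -normr_eq0 nmE v0. Qed.

Lemma nm_small v : (forall e : R, 0 < e -> nm v <= e) -> v = 0.
Proof.
move=> small; apply/nm_eq0/le_anti; rewrite nm_ge0 andbT.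
by apply/ler_addgt0Pr => e /small; rewrite add0r.
Qed.

Lemma nm_smallB u v : (forall e : R, 0 < e -> nm (u - v) <= e) -> u = v.
Proof. by move=> /nm_small /eqP; rewrite subr_eq0 => /eqP. Qed.

End Zmod.

Lemma nmM (a b : C) : nm (a * b) = nm a * nm b.
Proof. by rewrite {1}/nm normrM !nmE ReCM. Qed.

Lemma nmZ (V : normedModType C) (a : C) (v : V) : nm (a *: v) = nm a * nm v.
Proof. by rewrite {1}/nm normrZ !nmE ReCM. Qed.

Lemma nmJ (a : C) : nm a^* = nm a.
Proof. by rewrite /nm norm_conjC. Qed.

Lemma nmC (r : R) : 0 <= r -> nm (r%:C%C : C) = r.
Proof. by move=> r0; rewrite /nm ger0_norm // ler0c. Qed.

Lemma Re_le_nm (z : C) : complex.Re z <= nm z.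
Proof.
case: z => a b; rewrite /nm normc_def /=.
rewrite (le_trans (ler_norm a)) // -sqrtr_sqr ler_wsqrtr //.
by rewrite lerDl sqr_ge0.
Qed.

Lemma nm_le_ReIm (z : C) : nm z <= `|complex.Re z| + `|complex.Im z|.
Proof.
case: z => a b; rewrite /nm normc_def /=.
rewrite -[leRHS]ger0_norm ?addr_ge0 // -sqrtr_sqr ler_wsqrtr //.
by rewrite sqrrD !real_normK ?num_real // lerD2r lerDl mulrn_wge0 ?mulr_ge0.
Qed.

Lemma nmRe_le (z : C) : `|complex.Re z| <= nm z.
Proof.
by rewrite ler_norml Re_le_nm andbT lerNl -ReN -(nmN z) Re_le_nm.
Qed.

Lemma nmIm_le (z : C) : `|complex.Im z| <= nm z.
Proof.
case: z => a b; rewrite /nm normc_def /=.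
by rewrite -sqrtr_sqr ler_wsqrtr // lerDr sqr_ge0.
Qed.

Lemma nm_sq (z : C) : z * z^* = (nm z ^+ 2)%:C%C.
Proof. by rewrite -normCK nmE rmorphXn. Qed.

(** The Cauchy-Schwarz inequality, on the entries of a positive semi-definite
    2 x 2 matrix: in this form it applies to forms that are not defined on a
    vector space, such as [kform] below. *)
Lemma CauchySchwarz_entries (A B D : C) :
    (forall a b : C, 0 <= a * a^* * A + a * b^* * B + (a * b^* * B)^*
                          + b * b^* * D) ->
  nm B ^+ 2 <= complex.Re A * complex.Re D.
Proof.
move=> psd.
have A0 : 0 <= complex.Re A.
  have := psd 1 0; rewrite conjC1 conjC0 !(mulr0, mul0r, mulr1, mul1r, addr0).
  by rewrite conjC0 addr0; apply: Re_ge0.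
have D0 : 0 <= complex.Re D.
  have := psd 0 1; rewrite conjC1 conjC0 !(mulr0, mul0r, mulr1, mul1r, add0r).
  by rewrite conjC0 add0r; apply: Re_ge0.
(* The vector [a = - t B^*], [b = 1] gives a nonnegative real quadratic. *)
have quad (t : R) :
    0 <= t ^+ 2 * (nm B ^+ 2 * complex.Re A) - 2 * t * nm B ^+ 2 + complex.Re D.
  have := psd (- (t%:C%C * B^*)) 1.
  have -> : - (t%:C%C * B^*) * (- (t%:C%C * B^*))^* * A
      + - (t%:C%C * B^*) * 1^* * B + (- (t%:C%C * B^*) * 1^* * B)^* + 1 * 1^* * D
    = t%:C%C * (t%:C%C)^* * (B * B^*) * A - t%:C%C * (B * B^*)
      - (t%:C%C)^* * (B * B^*) + D.
    have := conjCK B; set b := B^* => bK; rewrite conjC1 !rmorphM !rmorphN.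
    by rewrite !rmorphM /= bK; ring.
  rewrite conjCR nm_sq => /Re_ge0.
  rewrite !(ReD, ReN) -!mulrA !ReCM /= => h; apply: (le_trans h).
  rewrite le_eqVlt; apply/orP; left; apply/eqP; ring.
have := sqr_ge0 (nm B); set x := nm B ^+ 2 in quad * => x0.
move: (complex.Re A) (complex.Re D) A0 D0 quad => a d a0 d0 quad.
have [a_gt0|a_le0] := ltP 0 a.
  have := quad a^-1.
  have -> : a^-1 ^+ 2 * (x * a) - 2 * a^-1 * x + d = d - x / a.
    by field; rewrite gt_eqF.
  by rewrite subr_ge0 ler_pdivrMr // mulrC.
have aE : a = 0 by apply/le_anti/andP.
rewrite aE mul0r leNgt; apply/negP => x_gt0.
have := quad ((d + 1) / x).
rewrite aE !mulr0 add0r.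
have -> : 2 * ((d + 1) / x) * x = 2 * (d + 1) by field; rewrite gt_eqF.
by lra.
Qed.

(** Completeness of the complex numbers.  The filter lives on the source of [f]
    because it will be a filter of approximations to a fixed vector. *)
Lemma complex_cauchy_cvg (T : Type) (F : set_system T) (FF : ProperFilter F)
    (f : T -> C) :
  (forall e : R, 0 < e ->
     exists2 A, F A & forall x y, A x -> A y -> nm (f x - f y) <= e) ->
  exists z, forall e : R, 0 < e -> exists2 A, F A & forall x, A x -> nm (f x - z) <= e.
Proof.
move=> cauchyf.
have part (g : C -> R) : (forall a b, `|g a - g b| <= nm (a - b)) ->
    exists r, forall e : R, 0 < e -> exists2 A, F A & forall x, A x -> `|g (f x) - r| <= e.
  move=> gle; have : cvg (g (f x) @[x --> F]).
    apply: R_complete; apply/cauchy_ballP => e e0.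
    have [A FA fA] := cauchyf _ (divr_gt0 e0 (ltr0n _ 2)).
    pose B : set R := [set g (f x) | x in A].
    have FB : F [set x | B (g (f x))] by apply: filterS FA => x Ax; exists x.
    exists (B, B); first by split.
    move=> [_ _] [/= [x Ax <-] [y Ay <-]] /=.
    rewrite /ball /= (le_lt_trans (gle _ _)) // (le_lt_trans (fA _ _ Ax Ay)) //.
    by rewrite ltr_pdivrMr // ltr_pMr // ltr1n.
  move=> /cvg_ex[r /cvgrPdist_le fr]; exists r => e /fr /= Fe.
  by eexists; first exact: Fe; move=> x /=; rewrite distrC.
have [|a ha] := part (@complex.Re R).
  by move=> a b; rewrite -ReN -ReD nmRe_le.
have [|b hb] := part (@complex.Im R).
  by move=> [? ?] [? ?]; apply: (le_trans _ (nmIm_le _)).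
exists (a +i* b)%C => e e0.
have e20 : 0 < e / 2 by rewrite divr_gt0.
have [A FA hA] := ha _ e20; have [B FB hB] := hb _ e20.
exists (A `&` B); first exact: filterI.
move=> x [/hA Ax /hB Bx]; rewrite (le_trans (nm_le_ReIm _)) //.
move: Ax Bx; case: (f x) => u v /= Ax Bx; lra.
Qed.

End RealNorm.

(** * Hilbert spaces: closed spans, the moment problem, projections, adjoints *)

Section HilbertSpace.
Variable R : realType.
Local Notation C := R[i].

(** The quantity [e / (1 + x)] is the precision that keeps an error multiplied by
    [x >= 0] below [e], without a case distinction on [x]. *)
Lemma div1D_gt0 (e x : R) : 0 < e -> 0 <= x -> 0 < e / (1 + x).
Proof. by move=> e0 x0; rewrite divr_gt0 // ltr_wpDr. Qed.

Lemma div1D_le (e x : R) : 0 <= e -> 0 <= x -> x * (e / (1 + x)) <= e.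
Proof.
by move=> e0 x0; rewrite mulrCA ler_piMr // ler_pdivrMr ?ltr_wpDr // mul1r lerDr.
Qed.

Section Comb.
Variables (V : lmodType C) (Y : Type) (v : Y -> V).

(** Formal combinations are lists, so that the values of one combination on
    different families can be compared. *)
Definition comb (c : seq (C * Y)) : V := \sum_(p <- c) p.1 *: v p.2.

Definition cscale (a : C) (c : seq (C * Y)) := [seq (a * p.1, p.2) | p <- c].

Lemma comb_nil : comb [::] = 0.
Proof. exact: big_nil. Qed.

Lemma comb1 y : comb [:: (1, y)] = v y.
Proof. by rewrite /comb big_seq1 scale1r. Qed.

Lemma comb_cat c d : comb (c ++ d) = comb c + comb d.
Proof. exact: big_cat. Qed.

Lemma comb_scale a c : comb (cscale a c) = a *: comb c.
Proof.
by rewrite /comb big_map scaler_sumr; apply: eq_bigr => p _; rewrite scalerA.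
Qed.

End Comb.

Section Inner.
Variable H : hilbertType R.
Implicit Types u v w : H.

Lemma innerDl u v w : inner (u + v) w = inner u w + inner v w.
Proof. by rewrite linearDl. Qed.

Lemma innerDr u v w : inner w (u + v) = inner w u + inner w v.
Proof. by rewrite linearDr. Qed.

Lemma innerBl u v w : inner (u - v) w = inner u w - inner v w.
Proof. by rewrite linearBl. Qed.

Lemma innerBr u v w : inner w (u - v) = inner w u - inner w v.
Proof. by rewrite linearBr. Qed.

Lemma innerZl a u w : inner (a *: u) w = a * inner u w.
Proof. by rewrite linearZl_LR. Qed.

Lemma innerZr a u w : inner w (a *: u) = a^* * inner w u.
Proof. by rewrite linearZr_LR. Qed.

Lemma inner0l w : inner 0 w = 0.
Proof. by rewrite linear0l. Qed.

Lemma inner0r w : inner w 0 = 0.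
Proof. by rewrite linear0r. Qed.

Lemma innerC u v : inner u v = (inner v u)^*.
Proof. by rewrite hermC expr0 mul1r. Qed.

Lemma inner_suml (I : Type) (r : seq I) (f : I -> H) w :
  inner (\sum_(i <- r) f i) w = \sum_(i <- r) inner (f i) w.
Proof. by rewrite linear_sumlz. Qed.

Lemma inner_sumr (I : Type) (r : seq I) (f : I -> H) w :
  inner w (\sum_(i <- r) f i) = \sum_(i <- r) inner w (f i).
Proof. by rewrite linear_sumr. Qed.

Lemma inner_nm u : inner u u = (nm u ^+ 2)%:C%C.
Proof. by rewrite -sqr_normE nmE rmorphXn. Qed.

Lemma inner_ge0 u : 0 <= inner u u.
Proof. by rewrite inner_nm ler0c sqr_ge0. Qed.

Lemma nm2E u : nm u ^+ 2 = complex.Re (inner u u).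
Proof. by rewrite inner_nm. Qed.

Lemma inner_eq0 u : inner u u = 0 -> u = 0.
Proof.
rewrite inner_nm => -[/eqP]; rewrite sqrf_eq0 => /eqP; exact: nm_eq0.
Qed.

Lemma inner_ext u v : (forall w, inner u w = inner v w) -> u = v.
Proof.
by move=> uv; apply/eqP; rewrite -subr_eq0; apply/eqP/inner_eq0;
   rewrite innerBl uv subrr.
Qed.

Lemma nm2D u v : nm (u + v) ^+ 2 = nm u ^+ 2 + nm v ^+ 2 + 2 * complex.Re (inner u v).
Proof.
rewrite !nm2E innerDl !innerDr (innerC v u) !ReD ReJ; ring.
Qed.

Lemma nm2B u v : nm (u - v) ^+ 2 = nm u ^+ 2 + nm v ^+ 2 - 2 * complex.Re (inner u v).
Proof. by rewrite nm2D nmN -scaleN1r innerZr rmorphN1 mulN1r ReN mulrN. Qed.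

Lemma inner_le_nm u v : nm (inner u v) <= nm u * nm v.
Proof.
rewrite -(@ler_pXn2r _ 2) ?nnegrE ?nm_ge0 ?mulr_ge0 ?nm_ge0 // exprMn !nm2E.
apply: CauchySchwarz_entries => a b.
have := inner_ge0 (a *: u + b *: v).
by rewrite innerDl !innerDr !innerZl !innerZr (innerC v u) !rmorphM /= conjCK;
  congr (_ <= _); ring.
Qed.

Lemma hilbert_cauchy_cvg (T : Type) (F : set_system T) (FF : ProperFilter F)
    (f : T -> H) :
  (forall e : R, 0 < e ->
     exists2 A, F A & forall x y, A x -> A y -> nm (f x - f y) <= e) ->
  exists z, forall e : R, 0 < e -> exists2 A, F A & forall x, A x -> nm (f x - z) <= e.
Proof.
move=> cauchyf.
have : cvg (f x @[x --> F]).
  apply: cauchy_cvg; apply/cauchy_ballP => e e0.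
  have re0 : 0 < complex.Re e by move: e0; rewrite ltcE => /andP[].
  have [A FA fA] := cauchyf _ (divr_gt0 re0 (ltr0n _ 2)).
  pose B : set H := [set f x | x in A].
  have FB : F [set x | B (f x)] by apply: filterS FA => x Ax; exists x.
  exists (B, B); first by split.
  move=> [_ _] [/= [x Ax <-] [y Ay <-]] /=.
  rewrite -ball_normE /ball_ /= nmE (ge0_Re (ltW e0)) ltcR.
  rewrite (le_lt_trans (fA _ _ Ax Ay)) //.
  by rewrite ltr_pdivrMr // ltr_pMr // ltr1n.
move=> /cvg_ex[z /cvgrPdist_le fz]; exists z => e e0.
have /fz Fe : 0 < e%:C%C by rewrite ltcR.
by eexists; first exact: Fe; move=> x /=; rewrite distrC nmE lecR.
Qed.

Lemma closed_approx (W : set H) u : closed W ->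
  (forall e : R, 0 < e -> exists2 w, W w & nm (u - w) <= e) -> W u.
Proof.
move=> clW approx; apply: clW => B /nbhs_ballP[e /= e0 eB].
have re0 : 0 < complex.Re e by move: e0; rewrite ltcE => /andP[].
have [w Ww uw] := approx _ (divr_gt0 re0 (ltr0n _ 2)).
exists w; split=> //; apply: eB.
rewrite -ball_normE /ball_ /= nmE (ge0_Re (ltW e0)) ltcR (le_lt_trans uw) //.
by rewrite ltr_pdivrMr // ltr_pMr // ltr1n.
Qed.

Lemma closedI (W : set H) :
  (forall u, (forall e : R, 0 < e -> exists2 w, W w & nm (u - w) <= e) -> W u) -> closed W.
Proof.
move=> approx u clu; apply: approx => e e0.
have [|w [Ww uw]] := clu (ball u e%:C%C).
  by apply/nbhs_ballP; exists e%:C%C => //=; rewrite ltcR.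
exists w => //; move: uw; rewrite -ball_normE /ball_ /= nmE ltcR; exact: ltW.
Qed.

Lemma closed_subspaceP (W : set H) : W 0 -> (forall a u v, W u -> W v -> W (a *: u + v)) ->
  (forall u, (forall e : R, 0 < e -> exists2 w, W w & nm (u - w) <= e) -> W u) ->
  closed_subspace W.
Proof.
move=> W0 Wlin Wcl; split; last exact: closedI.
split; first by rewrite inE.
by move=> a u v /set_mem Wu /set_mem Wv; apply/mem_set/Wlin.
Qed.

Section Subspace.
Variables (W : set H) (clW : closed_subspace W).

Lemma subspace0 : W 0.
Proof. by case: clW => -[/set_mem]. Qed.

Lemma subspace_lin a u v : W u -> W v -> W (a *: u + v).
Proof. by case: clW => -[_ h] _ /mem_set Wu /mem_set Wv; apply/set_mem/h. Qed.

Lemma subspaceZ a u : W u -> W (a *: u).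
Proof. by move=> Wu; rewrite -[_ *: _]addr0; apply: subspace_lin Wu subspace0. Qed.

Lemma subspaceD u v : W u -> W v -> W (u + v).
Proof. by move=> Wu Wv; rewrite -[u]scale1r; apply: subspace_lin. Qed.

Lemma subspace_sum (I : Type) (r : seq I) (f : I -> H) :
  (forall i, W (f i)) -> W (\sum_(i <- r) f i).
Proof.
move=> Wf; elim/big_rec: _ => [|i u _ Wu]; [exact: subspace0|exact: subspaceD].
Qed.

End Subspace.

Section Span.
Variables (Y : Type) (b : Y -> H).

Definition clspan : set H :=
  [set k | forall e : R, 0 < e -> exists c, nm (k - comb b c) <= e].

Lemma clspan_comb c : clspan (comb b c).
Proof. by move=> e e0; exists c; rewrite subrr nm0 ltW. Qed.

Lemma clspan_mem y : clspan (b y).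
Proof. by rewrite -(comb1 b) ; exact: clspan_comb. Qed.

Lemma clspan_sub (W : set H) : closed_subspace W -> (forall y, W (b y)) -> clspan `<=` W.
Proof.
move=> clW Wb k kb; have [_ W_closed] := clW; apply: (closed_approx W_closed) => e /kb[c kc].
by exists (comb b c) => //; apply: (subspace_sum clW) => p; apply: subspaceZ.
Qed.

Lemma clspan_closed : closed_subspace clspan.
Proof.
apply: closed_subspaceP => [|a u v ub vb e e0|u h e e0].
- by move=> e e0; exists [::]; rewrite comb_nil subrr nm0 ltW.
- have e1 : 0 < e / 2 / (1 + nm a).
    by rewrite !divr_gt0 // ltr_wpDr ?nm_ge0.
  have e2 : 0 < e / 2 by rewrite divr_gt0.
  have [c uc] := ub _ e1; have [d vd] := vb _ e2.
  exists (cscale a c ++ d); rewrite comb_cat comb_scale opprD addrACA -scalerBr.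
  rewrite (le_trans (nmD _ _)) // nmZ (splitr e) lerD //.
  apply: (le_trans (ler_wpM2l (nm_ge0 _) uc)).
  by rewrite div1D_le ?nm_ge0 // ltW.
- have e2 : 0 < e / 2 by rewrite divr_gt0.
  have [w wb uw] := h _ e2; have [c wc] := wb _ e2; exists c.
  by rewrite (le_trans (nm_dist w _ _)) // (splitr e) lerD.
Qed.

Lemma clspan_orth k u : clspan k -> (forall y, inner (b y) u = 0) -> inner k u = 0.
Proof.
move=> kb bu; apply: nm_small => e e0.
have e1 := div1D_gt0 e0 (nm_ge0 u).
have [c kc] := kb _ e1.
have -> : inner k u = inner (k - comb b c) u.
  rewrite innerBl (_ : inner (comb b c) u = 0) ?subr0 // inner_suml.
  by rewrite big1 // => p _; rewrite innerZl bu mulr0.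
apply: (le_trans (inner_le_nm _ _)).
apply: (le_trans (ler_wpM2r (nm_ge0 _) kc)).
by rewrite mulrC div1D_le ?nm_ge0 // ltW.
Qed.

Lemma clspan_inj k k' : clspan k -> clspan k' ->
  (forall y, inner (b y) k = inner (b y) k') -> k = k'.
Proof.
move=> kb kb' kk'; apply/eqP; rewrite -subr_eq0; apply/eqP/inner_eq0.
apply: clspan_orth => [|y]; last by rewrite innerBr kk' subrr.
by rewrite addrC -scaleN1r; apply: (subspace_lin clspan_closed).
Qed.

(** This is the Riesz representation theorem for a functional known only on a
    family.  Along the finite combinations [c], the almost-minimisers of
    [|b(c)|^2 - 2 Re phi(c)] form a Cauchy filter by the parallelogram law; the
    limit represents [phi] because the first variation vanishes there. *)
Lemma moment_problem (phi : Y -> C) (M : R) : 0 <= M ->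
    (forall c, nm (\sum_(p <- c) p.1 * phi p.2) <= M * nm (comb b c)) ->
  exists k, [/\ forall y, inner (b y) k = phi y, nm k <= M & clspan k].
Proof.
move=> M0 bounded.
pose ev (c : seq (C * Y)) := \sum_(p <- c) p.1 * phi p.2.
have ev_cat c d : ev (c ++ d) = ev c + ev d by exact: big_cat.
have ev_scale a c : ev (cscale a c) = a * ev c.
  by rewrite /ev big_map mulr_sumr; apply: eq_bigr => p _; rewrite mulrA.
pose r c := nm (comb b c) ^+ 2 - 2 * complex.Re (ev c).
have r_ge c : - M ^+ 2 <= r c.
  have := Re_le_nm (ev c); have := bounded c; rewrite -/(ev c) /r.
  move: (nm (comb b c)) (nm (ev c)) => x y xy yre.
  have := sqr_ge0 (x - M); nra.
have r_inf : has_inf (range r).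
  by split; [exists (r [::]), [::]|exists (- M ^+ 2) => _ [c _ <-]].
pose m := inf (range r).
have m_le c : m <= r c by apply: (ge_inf r_inf.2); exists c.
have near_m (e : R) : 0 < e -> exists c, r c <= m + e.
  by move=> e0; have [_ [c _ <-] /ltW] := inf_adherent e0 r_inf; exists c.
pose A (e : R) := [set c | r c <= m + e].
have parallelogram (e : R) c d : A e c -> A e d -> nm (comb b c - comb b d) ^+ 2 <= 4 * e.
  move=> Ac Ad; have := m_le (cscale (2^-1) (c ++ d)); move: Ac Ad.
  rewrite /A /= /r comb_scale comb_cat ev_scale ev_cat nmZ exprMn nm2D nm2B.
  have -> : (2^-1 : C) = (2^-1)%:C%C by rewrite fmorphV rmorph_nat.
  rewrite nmC ?invr_ge0 // ReCM ReD; lra.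
pose F := filter_from [set e : R | 0 < e] A.
have FF : ProperFilter F.
  apply: filter_from_proper; last by move=> e /near_m.
  apply: filter_from_filter; first by exists 1; rewrite /= ltr01.
  move=> e1 e2 /= e10 e20; exists (Num.min e1 e2) => [|c]; first by rewrite /= lt_min e10.
  rewrite /A /= => Ac; split; apply: (le_trans Ac); rewrite lerD2l ge_min lexx ?orbT //.
have [|k cvgk] := @hilbert_cauchy_cvg _ F FF (comb b).
  move=> e e0; exists (A (e ^+ 2 / 4)).
    by exists (e ^+ 2 / 4) => //=; rewrite divr_gt0 // exprn_gt0.
  move=> c d Ac Ad; rewrite -(@ler_pXn2r _ 2) ?nnegrE ?nm_ge0 ?(ltW e0) //.
  apply: (le_trans (parallelogram _ _ _ Ac Ad)).
  lra.
(* First variation at [c] in the direction [- t z^* d], with the step [t] chosen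
   so that the second order term is at most half of the first. *)
have variation (e : R) c d : A e c ->
    nm (inner (comb b d) (comb b c) - ev d) ^+ 2 <= e * (1 + nm (comb b d) ^+ 2).
  move=> Ac; set z := inner _ _ - _; set B := nm (comb b d) ^+ 2.
  have B0 : 0 <= B by rewrite sqr_ge0.
  pose t := (1 + B)^-1.
  have t0 : 0 < t by rewrite invr_gt0 ltr_wpDr.
  have := m_le (c ++ cscale (- (t%:C%C * z^*)) d); move: Ac.
  rewrite /A /= /r comb_cat comb_scale ev_cat ev_scale nm2D nmZ exprMn -/B.
  rewrite nmN nmM nmJ nmC ?(ltW t0) // innerZr.
  rewrite rmorphN rmorphM /= conjCR conjCK.
  rewrite (innerC (comb b c)) !mulNr ReD !ReN -!mulrA !ReCM => Ac.
  have -> : complex.Re (z * (inner (comb b d) (comb b c))^*)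
      = complex.Re (z^* * inner (comb b d) (comb b c)).
    by rewrite -[LHS]ReJ rmorphM /= conjCK.
  have zz : t * complex.Re (z^* * inner (comb b d) (comb b c))
      - t * complex.Re (z^* * ev d) = t * nm z ^+ 2.
    by rewrite -mulrBr -ReN -ReD -mulrBr -/z [z^* * z]mulrC nm_sq.
  have -> : t * (nm z * (t * (nm z * B))) = t ^+ 2 * nm z ^+ 2 * B by ring.
  move: (nm z ^+ 2) (sqr_ge0 (nm z)) zz => Z Z0 zz m_le_var.
  have tB : t * (1 + B) = 1 by rewrite mulVf // gt_eqF // ltr_wpDr.
  have Zt : Z * t <= e.
    have : Z * t * (1 + t) <= e.
      have -> : Z * t * (1 + t) = 2 * (t * Z) - t ^+ 2 * Z * B.
        have -> : t ^+ 2 * Z * B = t * Z * (t * (1 + B) - t) by ring.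
        by rewrite tB; ring.
      by move: Ac m_le_var zz; lra.
    apply: le_trans; rewrite ler_peMr ?mulr_ge0 ?(ltW t0) // lerDl ltW //.
  have -> : Z = Z * t * (1 + B) by rewrite -mulrA tB mulr1.
  by rewrite ler_wpM2r // addr_ge0.
have kb : clspan k.
  move=> e /cvgk[B [e' e'0 AB] BA]; have [c Ac] := near_m _ e'0.
  by exists c; rewrite nm_distC; apply/BA/AB.
have kE d : inner (comb b d) k = ev d.
  apply: nm_smallB => e e0; set B := nm (comb b d).
  have e2 : 0 < e / 2 by rewrite divr_gt0.
  have B0 : 0 < 1 + B ^+ 2 by rewrite ltr_wpDr // sqr_ge0.
  have [D [e' e'0 AD] DA] := cvgk _ (div1D_gt0 e2 (nm_ge0 (comb b d))).
  pose e'' := (e / 2) ^+ 2 / (1 + B ^+ 2).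
  have e''0 : 0 < e'' by rewrite divr_gt0 // exprn_gt0.
  have [|c] := near_m (Num.min e' e''); first by rewrite lt_min e''0 andbT.
  move=> Ac; rewrite (le_trans (nm_dist (inner (comb b d) (comb b c)) _ _)) //.
  rewrite (splitr e) lerD //.
    rewrite -innerBr (le_trans (inner_le_nm _ _)) // nm_distC.
    apply: (le_trans (ler_wpM2l (nm_ge0 _) (DA c _))).
      by apply: AD; rewrite /A /= (le_trans Ac) // lerD2l ge_min lexx.
    by rewrite div1D_le ?nm_ge0 // ltW.
  rewrite -(@ler_pXn2r _ 2) ?nnegrE ?nm_ge0 ?(ltW e2) //.
  apply: (le_trans (@variation e'' c d _)); last by rewrite divfK // gt_eqF.
  by rewrite /A /= (le_trans Ac) // lerD2l ge_min lexx orbT.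
exists k; split=> // [y|].
  by rewrite -(comb1 b) kE /ev big_seq1 mul1r.
apply: le_of_sqr; rewrite ?nm_ge0 //.
apply/ler_addgt0Pr => e e0.
have Mk : 0 <= M + nm k by rewrite addr_ge0 ?nm_ge0.
have [c kc] := kb _ (div1D_gt0 e0 Mk).
have -> : nm k ^+ 2 = complex.Re (inner (k - comb b c) k) + complex.Re (ev c).
  by rewrite -kE -ReD innerBl subrK nm2E.
have := Re_le_nm (inner (k - comb b c) k); have := inner_le_nm (k - comb b c) k.
have := Re_le_nm (ev c); have := bounded c; rewrite -/(ev c).
have := ler_wpM2l Mk kc; have := div1D_le (ltW e0) Mk.
have := nmB k (k - comb b c); rewrite opprB addrC subrK => /(ler_wpM2l M0).
lra.
Qed.

End Span.
End Inner.
End HilbertSpace.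

Section Operators.
Variable R : realType.
Local Notation C := R[i].

Section Linear.
Variables (V W : lmodType C) (T : V -> W).
Hypothesis Tlin : linear T.

Lemma linear_op0 : T 0 = 0.
Proof. by have := Tlin (-1) 0 0; rewrite !scaleN1r oppr0 addr0 addNr. Qed.

Lemma linear_opD u v : T (u + v) = T u + T v.
Proof. by have := Tlin 1 u v; rewrite !scale1r. Qed.

Lemma linear_opZ a u : T (a *: u) = a *: T u.
Proof. by have := Tlin a u 0; rewrite linear_op0 !addr0. Qed.

Lemma linear_opB u v : T (u - v) = T u - T v.
Proof. by rewrite linear_opD -scaleN1r linear_opZ scaleN1r. Qed.

Lemma linear_op_sum (I : Type) (r : seq I) (f : I -> V) :
  T (\sum_(i <- r) f i) = \sum_(i <- r) T (f i).
Proof.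
by elim: r => [|i r IHr]; rewrite ?big_nil ?linear_op0 // !big_cons linear_opD IHr.
Qed.

End Linear.

Section Bounded.
Variables (H K : hilbertType R) (T : H -> K).

Lemma contraction_bounded (M : R) : linear T ->
  (forall h, nm (T h) <= M * nm h) -> bounded_operator T.
Proof.
move=> Tlin TM; split=> // h; apply/cvgrPdist_le => e e0.
have M1 : 0 < 1 + `|M| by rewrite ltr_wpDr.
have re0 : 0 < complex.Re e by move: e0; rewrite ltcE => /andP[].
apply/nbhs_ballP; exists (complex.Re e / (1 + `|M|))%:C%C => /=.
  by rewrite ltcR divr_gt0.
move=> h'; rewrite -ball_normE /ball_ /= !nmE ltcR => hh'.
rewrite (ge0_Re (ltW e0)) lecR -linear_opB // (le_trans (TM _)) //.
apply: (le_trans (ler_wpM2r (nm_ge0 _) (ler_norm M))).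
apply: (le_trans (ler_wpM2l (normr_ge0 M) (ltW hh'))).
by rewrite div1D_le // ltW.
Qed.

Lemma bounded_approx : bounded_operator T -> forall h (e : R), 0 < e ->
  exists2 d : R, 0 < d & forall h', nm (h - h') <= d -> nm (T h - T h') <= e.
Proof.
move=> [Tlin Tcont] h e e0; have /cvgrPdist_le Th := Tcont h.
have /Th /nbhs_ballP[d /= d0 dT] : 0 < e%:C%C :> C by rewrite ltcR.
have rd0 : 0 < complex.Re d by move: d0; rewrite ltcE => /andP[].
exists (complex.Re d / 2); first by rewrite divr_gt0.
move=> h' hh'; rewrite -lecR -nmE; apply: dT.
rewrite -ball_normE /ball_ /= nmE (ge0_Re (ltW d0)) ltcR (le_lt_trans hh') //.
by rewrite ltr_pdivrMr // ltr_pMr // ltr1n.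
Qed.

Lemma preimage_closed_subspace (W : set K) : bounded_operator T -> closed_subspace W ->
  closed_subspace [set h | W (T h)].
Proof.
move=> bT clW; have [Tlin _] := bT; have [_ W_closed] := clW.
apply: closed_subspaceP => [|a u v /= Wu Wv|u uW /=].
- by rewrite /= linear_op0 //; exact: subspace0.
- by rewrite Tlin; apply: subspace_lin.
apply: (closed_approx W_closed) => e /(bounded_approx bT u)[d /uW[w Ww uw] dT].
by exists (T w) => //; apply: dT.
Qed.

(** An identity [<T t, f> = <t, g>] has to be checked on a total set only. *)
Lemma closed_inner_eq f g : bounded_operator T ->
  closed_subspace [set t | inner (T t) f = inner t g].
Proof.
move=> bT; have [Tlin _] := bT.
apply: closed_subspaceP => [|a u v /= uE vE|u uW /=].
- by rewrite /= linear_op0 // !inner0l.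
- by rewrite Tlin !innerDl !innerZl uE vE.
apply: nm_smallB => e e0.
have e2 : 0 < e / 2 by rewrite divr_gt0.
have [d d0 dT] := bounded_approx bT u (div1D_gt0 e2 (nm_ge0 f)).
have [|w /= wE uw] := uW (Num.min d (e / 2 / (1 + nm g))).
  by rewrite lt_min d0 div1D_gt0 // nm_ge0.
rewrite (le_trans (nm_dist (inner w g) _ _)) // (splitr e) lerD //.
  rewrite -wE -innerBl (le_trans (inner_le_nm _ _)) // mulrC.
  apply: (le_trans (ler_wpM2l (nm_ge0 _) (dT _ _))).
    by rewrite (le_trans uw) // ge_min lexx.
  by rewrite div1D_le ?nm_ge0 // ltW.
rewrite -innerBl (le_trans (inner_le_nm _ _)) // mulrC nm_distC.
apply: (le_trans (ler_wpM2l (nm_ge0 _) uw)).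
apply: (@le_trans _ _ (nm g * (e / 2 / (1 + nm g)))).
  by rewrite ler_wpM2l ?nm_ge0 // ge_min lexx orbT.
by rewrite div1D_le ?nm_ge0 // ltW.
Qed.

Lemma adjoint_exists (M : R) : 0 <= M -> linear T -> (forall h, nm (T h) <= M * nm h) ->
  exists T' : K -> H, [/\ forall h k, inner (T h) k = inner h (T' k), linear T'
    & forall k, nm (T' k) <= M * nm k].
Proof.
move=> M0 Tlin TM.
have adj k : exists h', (forall h, inner (T h) k = inner h h') /\ nm h' <= M * nm k.
  have Mk : 0 <= M * nm k by rewrite mulr_ge0 ?nm_ge0.
  have [c|h' [h'E h'M _]] := @moment_problem R H H id (fun h => inner (T h) k) _ Mk.
    have -> : \sum_(p <- c) p.1 * inner (T p.2) k = inner (T (comb id c)) k.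
      rewrite linear_op_sum // inner_suml.
      by apply: eq_bigr => p _; rewrite linear_opZ // innerZl.
    by rewrite (le_trans (inner_le_nm _ _)) // mulrAC ler_wpM2r ?nm_ge0.
  by exists h'; split=> // h; rewrite h'E.
have [T' T'P] := choice adj.
have T'E h k : inner (T h) k = inner h (T' k) by apply T'P.
exists T'; split=> // [a u v|k]; last by apply T'P.
apply: inner_ext => w; rewrite innerC -T'E innerC conjCK.
by rewrite innerDl innerZl innerDl innerZl !(innerC (T' _)) -!T'E -!innerC.
Qed.

End Bounded.

Lemma projection_exists (H : hilbertType R) (W : set H) : closed_subspace W ->
  exists P : H -> H, [/\ forall h, W (P h), forall w h, W w -> inner w (P h) = inner w h,
    forall w, W w -> P w = w, linear P & forall h, nm (P h) <= 1 * nm h].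
Proof.
move=> clW.
have proj h : exists k, [/\ W k, forall w, W w -> inner w k = inner w h & nm k <= nm h].
  pose b (w : {w | W w}) := sval w.
  have [c|k [kE kh kb]] := @moment_problem R H _ b (fun w => inner (b w) h) _ (nm_ge0 h).
    rewrite mulrC; apply: le_trans (inner_le_nm _ _).
    by rewrite inner_suml le_eqVlt; apply/orP; left; apply/eqP; congr nm;
       apply: eq_bigr => p _; rewrite innerZl.
  exists k; split=> // [|w Ww]; last exact: (kE (exist _ w Ww)).
  by apply: clspan_sub kb => // -[].
have [P PP] := choice proj.
have WP h : W (P h) by have [] := PP h.
have PE w h : W w -> inner w (P h) = inner w h by have [_ + _] := PP h; apply.
have P_uniq w h : W w -> (forall u, W u -> inner u w = inner u h) -> w = P h.
  move=> Ww wE; apply/eqP; rewrite -subr_eq0; apply/eqP/inner_eq0.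
  have Wd : W (w - P h) by rewrite addrC -scaleN1r; apply: subspace_lin.
  by rewrite innerBr wE // PE // subrr.
exists P; split=> // [w Ww|a u v|h]; last by rewrite mul1r; have [] := PP h.
  exact/esym/P_uniq.
apply/esym/P_uniq => [|w Ww]; first exact: subspace_lin.
by rewrite !innerDr !innerZr !PE.
Qed.

(** The operator [U] sends [a y] to [b y] and kills the orthogonal complement of
    the family [a].  It is obtained backwards, by prescribing
    [<U h, b y> = <h, a y>]: equality of the Gram matrices bounds this moment
    problem and forces the adjoint to send [b y] to [a y]. *)
Lemma gram_partial_isometry (H K : hilbertType R) (Y : Type) (a : Y -> H) (b : Y -> K) :
    (forall y z, inner (a y) (a z) = inner (b y) (b z)) ->
  exists (U : H -> K) (U' : K -> H),
    [/\ partial_isometry U, forall h k, inner (U h) k = inner h (U' k),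
        forall h y, inner (U h) (b y) = inner h (a y), forall h, clspan b (U h)
      & forall k, clspan b k -> U (U' k) = k].
Proof.
move=> gram.
have gram_comb c : nm (comb a c) = nm (comb b c).
  apply/eqP; rewrite -(@eqrXn2 _ 2) ?nm_ge0 // !nm2E; apply/eqP; congr complex.Re.
  rewrite !inner_suml; apply: eq_bigr => p _; rewrite !inner_sumr.
  by apply: eq_bigr => q _; rewrite !innerZl !innerZr gram.
have Uex h : exists k, [/\ forall y, inner (b y) k = inner (a y) h, nm k <= nm h & clspan b k].
  apply: moment_problem; rewrite ?nm_ge0 // => c; rewrite -gram_comb mulrC.
  apply: le_trans (inner_le_nm _ _).
  by rewrite inner_suml le_eqVlt; apply/orP; left; apply/eqP; congr nm;
     apply: eq_bigr => p _; rewrite innerZl.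
have [U UP] := choice Uex.
have Ub h : clspan b (U h) by have [] := UP h.
have UE h y : inner (b y) (U h) = inner (a y) h by have [] := UP h.
have Ulin : linear U.
  move=> z u v; apply: (@clspan_inj _ _ _ b) => // [|y].
    by apply: (subspace_lin (clspan_closed b)).
  by rewrite innerDr innerZr !UE innerDr innerZr.
have Ule h : nm (U h) <= 1 * nm h by rewrite mul1r; have [] := UP h.
have [U' [U'E U'lin U'le]] := adjoint_exists ler01 Ulin Ule.
have bU := contraction_bounded Ulin Ule.
have U'b y : U' (b y) = a y.
  by apply: inner_ext => w; rewrite innerC -U'E innerC conjCK UE.
have Ua y : U (a y) = b y.
  apply: (@clspan_inj _ _ _ b) => // [|z]; first exact: clspan_mem.
  by rewrite UE gram.
have UU'k k : clspan b k -> U (U' k) = k.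
  move=> kb; apply: inner_ext => w.
  have bUU' : bounded_operator (U \o U').
    apply: (@contraction_bounded _ _ _ 1) => [z u v|h] /=; first by rewrite U'lin Ulin.
    by rewrite mul1r (le_trans (Ule _)) // mul1r -[leRHS]mul1r.
  by apply: (clspan_sub (closed_inner_eq w w bUU')) kb => y /=; rewrite U'b Ua.
exists U, U'; split=> //; last by move=> h y; rewrite innerC UE -innerC.
split=> // h hker; rewrite !nmE; congr (_%:C)%C.
apply/eqP; rewrite -(@eqrXn2 _ 2) ?nm_ge0 // !nm2E; apply/eqP; congr complex.Re.
have /hker : U (U' (U h) - h) = 0 by rewrite linear_opB // UU'k // subrr.
by rewrite innerBr -U'E => /eqP; rewrite subr_eq0 => /eqP.
Qed.

End Operators.

(** * The Hilbert space of a positive semi-definite kernel *)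

(** Positivity of the 2 x 2 sections, tested on [(1, 1)] and [(1, i)], implies
    that the kernel is hermitian. *)
Lemma kernelC (R : realType) (X : Type) (k : X -> X -> R[i]) : kernel k ->
  forall x y, k x y = (k y x)^*.
Proof.
move=> kk x y.
have k1 z : (k z z)^* = k z z.
  have := kk 1%N (fun=> z) (fun=> 1); rewrite !big_ord1 conjC1 mul1r mulr1.
  by move/geC0_conj.
have kb (b : R[i]) : (k x y * b + b^* * k y x)^* = k x y * b + b^* * k y x.
  have := kk 2%N (fun i => if i == ord0 then x else y) (fun i => if i == ord0 then 1 else b).
  rewrite !big_ord_recl !big_ord0 /= conjC1 !(mul1r, mulr1, addr0) => /geC0_conj.
  rewrite !rmorphD !rmorphM /= !k1 conjCK => h.
  apply: (addrI (k x x + b^* * k y y * b)).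
  transitivity (k x x + k x y * b + (b^* * k y x + b^* * k y y * b)); last by ring.
  by rewrite -h; ring.
have := kb 1; have := kb 'i; rewrite conjC1 !rmorphD !rmorphM /= conjC1 conjCK conjCi => hi h1.
have h2 : - ((k x y)^*) + (k y x)^* = k x y - k y x.
  have i0 : 'i != 0 :> R[i] by exact: neq0Ci.
  apply: (mulfI i0); transitivity (k x y * 'i + - 'i * k y x); last by ring.
  by rewrite -hi; ring.
have : (k y x)^* + (k y x)^* = k x y + k x y.
  move: h1; rewrite !mulr1 !mul1r => h1.
  transitivity ((k x y + k y x) + (k x y - k y x)); last by ring.
  by rewrite -h1 -h2; ring.
have n20 : 1 + 1 != 0 :> R[i] by rewrite lt0r_neq0 // addr_gt0 ?ltr01.
by move=> h; apply: (mulfI n20); rewrite !mulrDl !mul1r h.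
Qed.

(** The space is realised by functions on [Y], a vector [phi] of the space
    being identified with [y |-> <phi, v_y>].  It consists of the functions that
    are limits of combinations of the [k(., y)] in the dual norm of the
    semi-normed space of formal combinations; in this way no quotient and no
    completion have to be formed. *)

Section GramSpace.
Variables (R : realType) (Y : Type).
Local Notation C := R[i].

(** A bundled kernel, so that the structures on [gram_space k], which rest on
    the positivity of [k], can be inferred from [k]. *)
Structure psd_kernel := PsdKernel { psd_fun :> Y -> Y -> C ; psd_funP : kernel psd_fun }.

Variable k : psd_kernel.

(** The inner product of [phi] with the vector of the combination [d]. *)
Definition ev (phi : Y -> C) (d : seq (C * Y)) : C := \sum_(p <- d) p.1^* * phi p.2.

Definition kcomb (c : seq (C * Y)) : Y -> C := fun y => \sum_(p <- c) k y p.2 * p.1.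

Definition kform (d c : seq (C * Y)) : C := ev (kcomb c) d.

Definition cdiff (c d : seq (C * Y)) := c ++ cscale (-1) d.

Lemma ev_cat phi c d : ev phi (c ++ d) = ev phi c + ev phi d.
Proof. exact: big_cat. Qed.

Lemma ev_scale phi a c : ev phi (cscale a c) = a^* * ev phi c.
Proof.
by rewrite /ev big_map mulr_sumr; apply: eq_bigr => p _; rewrite rmorphM mulrA.
Qed.

Lemma ev_diff phi c d : ev phi (cdiff c d) = ev phi c - ev phi d.
Proof. by rewrite ev_cat ev_scale rmorphN1 mulN1r. Qed.

Lemma ev_lin a (phi psi : Y -> C) d : ev (a *: phi + psi) d = a * ev phi d + ev psi d.
Proof.
rewrite /ev mulr_sumr -big_split; apply: eq_bigr => p _ /=.
by rewrite mulrDr mulrCA.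
Qed.

Lemma ev1 phi y : ev phi [:: (1, y)] = phi y.
Proof. by rewrite /ev big_seq1 conjC1 mul1r. Qed.

Lemma kformC d c : kform d c = (kform c d)^*.
Proof.
rewrite /kform /ev /kcomb rmorph_sum /=.
under eq_bigr => p _ do rewrite mulr_sumr.
rewrite exchange_big; apply: eq_bigr => r _ /=; rewrite rmorphM /= conjCK rmorph_sum mulr_sumr.
apply: eq_bigr => p _ /=; rewrite rmorphM /= (kernelC (psd_funP k) p.2); ring.
Qed.

Lemma kform_ge0 c : 0 <= kform c c.
Proof.
rewrite /kform /ev /kcomb big_tnth.
under eq_bigr do rewrite big_tnth mulr_sumr; under eq_bigr do under eq_bigr do rewrite mulrA.
exact: (psd_funP k (fun i => (tnth (in_tuple c) i).2) (fun i => (tnth (in_tuple c) i).1)).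
Qed.

Lemma kform_catl d d' c : kform (d ++ d') c = kform d c + kform d' c.
Proof. exact: ev_cat. Qed.

Lemma kform_scalel a d c : kform (cscale a d) c = a^* * kform d c.
Proof. exact: ev_scale. Qed.

Lemma kform_catr d c c' : kform d (c ++ c') = kform d c + kform d c'.
Proof. by rewrite kformC kform_catl rmorphD /= -!kformC. Qed.

Lemma kform_scaler d a c : kform d (cscale a c) = a * kform d c.
Proof. by rewrite kformC kform_scalel rmorphM /= conjCK -kformC. Qed.

Lemma kform_diffr d c c' : kform d (cdiff c c') = kform d c - kform d c'.
Proof. by rewrite kform_catr kform_scaler mulN1r. Qed.

Definition knorm (c : seq (C * Y)) : R := Num.sqrt (complex.Re (kform c c)).

Lemma knorm_ge0 c : 0 <= knorm c.
Proof. exact: sqrtr_ge0. Qed.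

Lemma knorm2 c : knorm c ^+ 2 = complex.Re (kform c c).
Proof. by rewrite sqr_sqrtr // Re_ge0 // kform_ge0. Qed.

Lemma kform_le d c : nm (kform d c) <= knorm d * knorm c.
Proof.
rewrite -(@ler_pXn2r _ 2) ?nnegrE ?nm_ge0 ?mulr_ge0 ?knorm_ge0 // exprMn !knorm2.
apply: CauchySchwarz_entries => a b.
have := kform_ge0 (cscale a^* d ++ cscale b^* c).
rewrite kform_catr !kform_scaler !kform_catl !kform_scalel !conjCK (kformC c d).
by rewrite !rmorphM /= conjCK; congr (_ <= _); ring.
Qed.

(** The dual norm of [phi - kcomb c] is at most [e]. *)
Definition approximates (phi : Y -> C) c (e : R) :=
  forall d, nm (ev phi d - kform d c) <= e * knorm d.

Definition approximable (phi : Y -> C) :=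
  forall e : R, 0 < e -> exists c, approximates phi c e.

Lemma approximates_lin a (phi psi : Y -> C) c d e e' :
  approximates phi c e -> approximates psi d e' ->
  approximates (a *: phi + psi) (cscale a c ++ d) (nm a * e + e').
Proof.
move=> hc hd f; rewrite ev_lin kform_catr kform_scaler opprD addrACA -mulrBr.
by rewrite (le_trans (nmD _ _)) // mulrDl lerD // nmM -mulrA ler_wpM2l ?nm_ge0.
Qed.

Lemma approximates_le phi c e e' : e <= e' -> approximates phi c e -> approximates phi c e'.
Proof. by move=> ee' h d; rewrite (le_trans (h d)) // ler_wpM2r ?knorm_ge0. Qed.

Lemma approximates_kcomb c e : 0 <= e -> approximates (kcomb c) c e.
Proof. by move=> e0 d; rewrite subrr nm0 mulr_ge0 ?knorm_ge0. Qed.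

Lemma approximates_dist phi c c' e e' : 0 <= e -> 0 <= e' ->
  approximates phi c e -> approximates phi c' e' -> knorm (cdiff c c') <= e + e'.
Proof.
move=> e0 e'0 hc hc'; set f := cdiff c c'.
apply: le_of_sqr; rewrite ?knorm_ge0 ?addr_ge0 //.
rewrite knorm2 {2}/f kform_diffr (le_trans (Re_le_nm _)) //.
rewrite (le_trans (nm_dist (ev phi f) _ _)) // mulrDl lerD //.
by rewrite nm_distC.
Qed.

Lemma approximates_bound phi c e d : approximates phi c e ->
  nm (ev phi d) <= (knorm c + e) * knorm d.
Proof.
move=> h; rewrite -(subrK (kform d c) (ev phi d)) (le_trans (nmD _ _)) //.
by rewrite addrC mulrDl lerD // mulrC kform_le.
Qed.

Lemma approximates_knorm phi c e M : 0 <= M -> 0 <= e ->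
  (forall d, nm (ev phi d) <= M * knorm d) -> approximates phi c e -> knorm c <= M + e.
Proof.
move=> M0 e0 phiM h; apply: le_of_sqr; rewrite ?knorm_ge0 ?addr_ge0 //.
rewrite knorm2 (le_trans (Re_le_nm _)) // -(subrK (ev phi c) (kform c c)).
by rewrite (le_trans (nmD _ _)) // addrC mulrDl lerD // nm_distC.
Qed.

Lemma approximable_bound phi : approximable phi ->
  exists2 M, 0 <= M & forall d, nm (ev phi d) <= M * knorm d.
Proof.
move=> /(_ _ ltr01)[c h]; exists (knorm c + 1); first by rewrite addr_ge0 ?knorm_ge0.
by move=> d; apply: approximates_bound.
Qed.

Definition approximable_pred : {pred Y -> C} := fun phi => `[< approximable phi >].

Lemma approximable_submod : submod_closed approximable_pred.
Proof.
split=> [|a phi psi].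
  apply/asboolP => e e0; exists [::] => d.
  rewrite /kform /kcomb /ev -sumrB big1 ?nm0 ?mulr_ge0 ?knorm_ge0 ?(ltW e0) // => p _.
  by rewrite big_nil mulr0 subrr.
move=> /asboolP hphi /asboolP hpsi; apply/asboolP => e e0.
have e2 : 0 < e / 2 by rewrite divr_gt0.
have [c hc] := hphi _ (div1D_gt0 e2 (nm_ge0 a)).
have [d hd] := hpsi _ e2.
exists (cscale a c ++ d); apply: (approximates_le _ (approximates_lin a hc hd)).
by rewrite [leRHS](splitr e) lerD2r div1D_le ?nm_ge0 // ltW.
Qed.

HB.instance Definition _ :=
  GRing.isSubmodClosed.Build C (Y -> C) approximable_pred approximable_submod.

Record gram_space := GramSpace {
  gram_fun :> Y -> C ;
  gram_funP : gram_fun \in approximable_pred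
}.

HB.instance Definition _ := [isSub of gram_space for gram_fun].
HB.instance Definition _ := [Choice of gram_space by <:].
HB.instance Definition _ := [SubChoice_isSubLmodule of gram_space by <:].

Lemma gram_approx (phi : gram_space) : approximable phi.
Proof. exact/asboolP/gram_funP. Qed.

Lemma gram_ev_lin a (phi psi : gram_space) d :
  ev (a *: phi + psi) d = a * ev phi d + ev psi d.
Proof. exact: ev_lin. Qed.


End GramSpace.

Section GramInner.
Variables (R : realType) (Y : Type) (k : psd_kernel R Y).
Local Notation C := R[i].
Local Notation H := (gram_space k).
Implicit Types phi psi : H.

Lemma approximation_filter phi :
  ProperFilter (filter_from [set e : R | 0 < e] (fun e => [set c | approximates k phi c e])).
Proof.
apply: filter_from_proper; last by move=> e /(gram_approx phi).
apply: filter_from_filter; first by exists 1; rewrite /= ltr01.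
move=> e1 e2 /= e10 e20; exists (Num.min e1 e2) => [|c]; first by rewrite /= lt_min e10.
by move=> h; split; apply: approximates_le h; rewrite ge_min lexx ?orbT.
Qed.

(** The inner product of [phi] and [psi] is the limit of [ev phi c] as the
    combination [c] tends to [psi]. *)
Definition is_inner phi psi (z : C) := forall e : R, 0 < e ->
  exists2 d : R, 0 < d & forall c, approximates k psi c d -> nm (ev phi c - z) <= e.

Lemma inner_exists phi psi : exists z, is_inner phi psi z.
Proof.
have [M M0 phiM] := approximable_bound (gram_approx phi).
have [|z zP] := @complex_cauchy_cvg R _ _ (approximation_filter psi) (ev phi).
  move=> e e0; set d := e / (1 + M) / 2.
  have d0 : 0 < d by rewrite divr_gt0 // div1D_gt0.
  exists [set c | approximates k psi c d]; first by exists d.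
  move=> c c' /= hc hc'; rewrite -ev_diff (le_trans (phiM _)) //.
  apply: (le_trans (ler_wpM2l M0 (approximates_dist (ltW d0) (ltW d0) hc hc'))).
  by rewrite -splitr div1D_le // ltW.
exists z => e /zP[A [d d0 dA] Az]; exists d => // c hc.
by apply/Az/dA.
Qed.

Definition gram_inner phi psi : C := sval (cid (inner_exists phi psi)).

Lemma gram_innerP phi psi : is_inner phi psi (gram_inner phi psi).
Proof. exact: svalP. Qed.

Lemma is_inner_uniq phi psi z : is_inner phi psi z -> gram_inner phi psi = z.
Proof.
move=> hz; apply: nm_smallB => e e0.
have e2 : 0 < e / 2 by rewrite divr_gt0.
have [d d0 hd] := hz _ e2; have [d' d'0 hd'] := gram_innerP phi psi e2.
have [|c hc] := gram_approx psi (_ : 0 < Num.min d d'); first by rewrite lt_min d0.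
rewrite (le_trans (nm_dist (ev phi c) _ _)) // (splitr e) lerD //.
  by rewrite nm_distC; apply/hd'/(approximates_le _ hc); rewrite ge_min lexx orbT.
by apply/hd/(approximates_le _ hc); rewrite ge_min lexx.
Qed.

Lemma gram_inner_lin a phi phi' psi :
  gram_inner (a *: phi + phi') psi = a * gram_inner phi psi + gram_inner phi' psi.
Proof.
apply: is_inner_uniq => e e0.
have e2 : 0 < e / 2 by rewrite divr_gt0.
have [d d0 hd] := gram_innerP phi psi (div1D_gt0 e2 (nm_ge0 a)).
have [d' d'0 hd'] := gram_innerP phi' psi e2.
exists (Num.min d d') => [|c hc]; first by rewrite lt_min d0.
rewrite gram_ev_lin opprD addrACA -mulrBr (le_trans (nmD _ _)) // (splitr e) lerD //.
  rewrite nmM; apply: le_trans (div1D_le (ltW e2) (nm_ge0 a)).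
  by rewrite ler_wpM2l ?nm_ge0 //; apply/hd/(approximates_le _ hc); rewrite ge_min lexx.
by apply/hd'/(approximates_le _ hc); rewrite ge_min lexx orbT.
Qed.

(** If [c] is close to [psi] and [c'] to [phi], both sides are close to
    [kform c c'].  The approximations are chosen of bounded norm, since the
    error is proportional to their norms. *)
Lemma gram_innerC phi psi : gram_inner phi psi = (gram_inner psi phi)^*.
Proof.
apply: nm_smallB => e e0.
have [M M0 phiM] := approximable_bound (gram_approx phi).
have [M' M'0 psiM] := approximable_bound (gram_approx psi).
have e4 : 0 < e / 2 / 2 by rewrite !divr_gt0.
have [d1 d10 h1] := gram_innerP phi psi e4; have [d2 d20 h2] := gram_innerP psi phi e4.
pose d3 := e / 2 / 2 / (1 + (M + M' + 1)).
have d30 : 0 < d3 by rewrite div1D_gt0 // !addr_ge0.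
have small x d : 0 <= x -> x <= M + M' + 1 -> 0 <= d -> d <= d3 -> d * x <= e / 2 / 2.
  move=> x0 xM dge0 dd3; have := div1D_le (ltW e4) (_ : 0 <= M + M' + 1).
  rewrite -/d3 => h; apply: le_trans (h _); last by rewrite !addr_ge0.
  by rewrite mulrC ler_pM.
pose d := Num.min (Num.min d1 d2) (Num.min d3 1).
have d0 : 0 < d by rewrite !lt_min d10 d20 d30 ltr01.
have d1E : d <= d1 by rewrite !ge_min lexx.
have d2E : d <= d2 by rewrite !ge_min lexx !orbT.
have d3E : d <= d3 by rewrite !ge_min lexx !orbT.
have dle1 : d <= 1 by rewrite !ge_min lexx !orbT.
have [c hc] := gram_approx psi d0; have [c' hc'] := gram_approx phi d0.
have nc := approximates_knorm M'0 (ltW d0) psiM hc.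
have nc' := approximates_knorm M0 (ltW d0) phiM hc'.
have hA := h1 c (approximates_le d1E hc).
have hB := h2 c' (approximates_le d2E hc').
have hC := hc c'; have hD := hc' c.
have hC' : d * knorm k c' <= e / 2 / 2.
  by apply: small; rewrite ?knorm_ge0 ?(ltW d0) // (le_trans nc') //; lra.
have hD' : d * knorm k c <= e / 2 / 2.
  by apply: small; rewrite ?knorm_ge0 ?(ltW d0) // (le_trans nc) //; lra.
rewrite (le_trans (nm_dist (kform k c c') _ _)) // (splitr e) lerD //.
  rewrite (le_trans (nm_dist (ev phi c) _ _)) // (splitr (e / 2)) lerD //.
    by rewrite nm_distC.
  exact: le_trans hD hD'.
rewrite kformC -rmorphB nmJ (le_trans (nm_dist (ev psi c') _ _)) // (splitr (e / 2)) lerD //.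
by rewrite nm_distC (le_trans hC).
Qed.

Lemma gram_inner_ge0 phi : 0 <= gram_inner phi phi.
Proof.
have zJ : (gram_inner phi phi)^* = gram_inner phi phi by rewrite -gram_innerC.
suff : 0 <= complex.Re (gram_inner phi phi).
  move: zJ; case: (gram_inner phi phi) => a b /= [b0] a0; rewrite lecE /= a0 andbT.
  by apply/eqP; move: b0; lra.
have [M M0 phiM] := approximable_bound (gram_approx phi).
rewrite -oppr_le0; apply/ler_addgt0Pr => e e0; rewrite add0r.
have e2 : 0 < e / 2 by rewrite divr_gt0.
have M10 : 0 <= M + 1 by rewrite addr_ge0.
have [d d0 hd] := gram_innerP phi phi e2.
have d30 := div1D_gt0 e2 M10; set d3 := e / 2 / _ in d30.
pose d' := Num.min d (Num.min d3 1).
have d'0 : 0 < d' by rewrite !lt_min d0 d30 ltr01.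
have d1E : d' <= d by rewrite !ge_min lexx.
have d3E : d' <= d3 by rewrite !ge_min lexx !orbT.
have dle1 : d' <= 1 by rewrite !ge_min lexx !orbT.
have [c hc] := gram_approx phi d'0.
have nc := approximates_knorm M0 (ltW d'0) phiM hc.
have hA := hd c (approximates_le d1E hc).
have hB := hc c.
have hB' : d' * knorm k c <= e / 2.
  apply: le_trans (div1D_le (ltW e2) M10); rewrite -/d3 mulrC ler_pM ?knorm_ge0 ?(ltW d'0) //.
  by rewrite (le_trans nc) // lerD2l.
have := Re_ge0 (kform_ge0 k c).
have := Re_le_nm (ev phi c - gram_inner phi phi); rewrite ReD ReN.
have := Re_le_nm (kform k c c - ev phi c); rewrite ReD ReN nm_distC.
lra.
Qed.

Lemma kcombP c : kcomb k c \in approximable_pred k.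
Proof.
by apply/asboolP => e e0; exists c; apply: approximates_kcomb (ltW e0).
Qed.

Definition gram_comb c : H := GramSpace (kcombP c).

Lemma gram_inner_comb phi c : gram_inner phi (gram_comb c) = ev phi c.
Proof.
have [M M0 phiM] := approximable_bound (gram_approx phi).
apply: is_inner_uniq => e e0.
exists (e / (1 + M)) => [|c' hc']; first by rewrite div1D_gt0.
have hc : approximates k (gram_comb c) c 0 by exact: approximates_kcomb.
rewrite -ev_diff (le_trans (phiM _)) //; apply: le_trans (div1D_le (ltW e0) M0).
rewrite ler_wpM2l // -[leRHS]addr0.
by apply: approximates_dist hc' hc => //; rewrite ltW // div1D_gt0.
Qed.

Lemma gram_CauchySchwarz phi psi :
  nm (gram_inner phi psi) ^+ 2
    <= complex.Re (gram_inner phi phi) * complex.Re (gram_inner psi psi).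
Proof.
apply: CauchySchwarz_entries => a b.
have inD u v w : gram_inner (u + v) w = gram_inner u w + gram_inner v w.
  by rewrite -[u]scale1r gram_inner_lin mul1r scale1r.
have in0 w : gram_inner 0 w = 0.
  by have := gram_inner_lin (-1) 0 0 w; rewrite scaleN1r oppr0 addr0 mulN1r addNr.
have inZ c u w : gram_inner (c *: u) w = c * gram_inner u w.
  by rewrite -[c *: u]addr0 gram_inner_lin in0 addr0.
have := gram_inner_ge0 (a *: phi + b *: psi); rewrite inD !inZ.
rewrite !(gram_innerC _ (_ + _)) !inD !inZ !rmorphD !rmorphM /= -!gram_innerC.
by rewrite (gram_innerC psi phi) conjCK; congr (_ <= _); ring.
Qed.

Definition gram_norm phi : R := Num.sqrt (complex.Re (gram_inner phi phi)).

Lemma gram_norm2 phi : gram_norm phi ^+ 2 = complex.Re (gram_inner phi phi).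
Proof. by rewrite sqr_sqrtr // Re_ge0 // gram_inner_ge0. Qed.

Lemma gram_norm_ge0 phi : 0 <= gram_norm phi.
Proof. exact: sqrtr_ge0. Qed.

Lemma gram_inner_le phi psi : nm (gram_inner phi psi) <= gram_norm phi * gram_norm psi.
Proof.
rewrite -(@ler_pXn2r _ 2) ?nnegrE ?nm_ge0 ?mulr_ge0 ?gram_norm_ge0 // exprMn !gram_norm2.
exact: gram_CauchySchwarz.
Qed.

Lemma gram_ev_le phi d : nm (ev phi d) <= gram_norm phi * knorm k d.
Proof.
rewrite -gram_inner_comb (le_trans (gram_inner_le _ _)) //.
by rewrite {2}/gram_norm gram_inner_comb.
Qed.

Lemma gram_norm_eq0 phi : gram_norm phi = 0 -> phi = 0.
Proof.
move=> phi0; apply: val_inj; apply/funext => y /=.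
rewrite -(ev1 phi); apply/nm_eq0/le_anti; rewrite nm_ge0 andbT.
by rewrite (le_trans (gram_ev_le _ _)) // phi0 mul0r.
Qed.

Lemma gram_dot_bilinear : bilinear_for *%R (Num.conj \; *%R) gram_inner.
Proof.
split=> psi a u v; first exact: gram_inner_lin.
by rewrite gram_innerC gram_inner_lin rmorphD rmorphM /= -!gram_innerC.
Qed.

HB.instance Definition _ := bilinear_isBilinear.Build C H H C *%R (Num.conj \; *%R)
  gram_inner gram_dot_bilinear.

Lemma gram_inner_hermitian phi psi :
  gram_inner phi psi = (-1) ^+ false * (gram_inner psi phi)^*.
Proof. by rewrite expr0 mul1r gram_innerC. Qed.

HB.instance Definition _ := isHermitianSesquilinear.Build C H false Num.conj
  gram_inner gram_inner_hermitian.

Lemma gram_inner_gt0 phi : phi != 0 -> 0 < gram_inner phi phi.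
Proof.
move=> phi_neq0; rewrite lt_def gram_inner_ge0 andbT; apply: contraNneq phi_neq0.
by move=> phi0; rewrite (gram_norm_eq0 (phi := phi)) // /gram_norm phi0 sqrtr0.
Qed.

HB.instance Definition _ := isDotProduct.Build C H gram_inner gram_inner_gt0.

Definition gram_cnorm phi : C := (gram_norm phi)%:C%C.

Lemma gram_cnormD phi psi : gram_cnorm (phi + psi) <= gram_cnorm phi + gram_cnorm psi.
Proof.
rewrite /gram_cnorm -rmorphD lecR -(@ler_pXn2r _ 2) ?nnegrE ?addr_ge0 ?gram_norm_ge0 //.
rewrite gram_norm2 sqrrD !gram_norm2 linearDl !linearDr /= (gram_innerC psi phi) !ReD ReJ.
have := gram_inner_le phi psi; have := Re_le_nm (gram_inner phi psi).
lra.
Qed.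

Lemma gram_cnormZ a phi : gram_cnorm (a *: phi) = `|a| * gram_cnorm phi.
Proof.
rewrite /gram_cnorm nmE -rmorphM; congr (_%:C)%C; apply/eqP.
rewrite -(@eqrXn2 _ 2) ?mulr_ge0 ?gram_norm_ge0 ?nm_ge0 // exprMn !gram_norm2.
by rewrite linearZl_LR /= linearZr_LR /= mulrA nm_sq ReCM.
Qed.

Lemma gram_cnorm_eq0 phi : gram_cnorm phi = 0 -> phi = 0.
Proof. by move=> [] /gram_norm_eq0. Qed.

HB.instance Definition _ := Lmodule_isNormed.Build C H
  gram_cnormD gram_cnormZ gram_cnorm_eq0.

Lemma gram_nmE phi : nm phi = gram_norm phi.
Proof. by []. Qed.

Lemma gram_norm_le phi (e : R) : 0 <= e ->
  (forall d, nm (ev phi d) <= e * knorm k d) -> gram_norm phi <= e.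
Proof.
move=> e0 phie; rewrite -(@ler_pXn2r _ 2) ?nnegrE ?gram_norm_ge0 //.
apply/ler_addgt0Pr => t t0; have t2 : 0 < t / 2 by rewrite divr_gt0.
have [d d0 hd] := gram_innerP phi phi t2.
have d'0 := div1D_gt0 t2 e0; have ed' := div1D_le (ltW t2) e0.
set d' := t / 2 / _ in d'0 ed'.
have [|c hc] := gram_approx phi (_ : 0 < Num.min d d'); first by rewrite lt_min d0.
have hcd' : approximates k phi c d' by apply: approximates_le hc; rewrite ge_min lexx orbT.
have := ler_wpM2l e0 (approximates_knorm e0 (ltW d'0) phie hcd').
have /hd : approximates k phi c d by apply: approximates_le hc; rewrite ge_min lexx.
have := Re_le_nm (ev phi c); have := phie c.
have := Re_le_nm (gram_inner phi phi - ev phi c); rewrite nm_distC ReD ReN gram_norm2.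
lra.
Qed.

Lemma gram_evB phi psi d : ev (phi - psi) d = ev phi d - ev psi d.
Proof.
have -> : phi - psi = -1 *: psi + phi by rewrite scaleN1r addrC.
by rewrite gram_ev_lin mulN1r addrC.
Qed.

(** A Cauchy filter converges pointwise, hence along every combination.  A
    member of the filter that is uniformly close to the limit shares its
    approximations with it, so the limit is in the space. *)
Lemma gram_complete (F : set_system H) : ProperFilter F -> cauchy F -> cvg F.
Proof.
move=> FF /cauchy_ballP Fc.
have diam (e : R) : 0 < e ->
    exists2 A, F A & forall phi psi, A phi -> A psi -> nm (phi - psi) <= e.
  move=> e0; have ec0 : 0 < (e / 2)%:C%C :> C by rewrite ltcR divr_gt0.
  have /cauchyP/(_ _ ec0)[phi0 Fphi0] : cauchy F by apply/cauchy_ballP.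
  exists (ball phi0 (e / 2)%:C%C) => // phi psi.
  rewrite -!ball_normE /ball_ /= !nmE !ltcR => h1 h2.
  rewrite (le_trans (nm_dist phi0 _ _)) // (splitr e) lerD // ltW //.
  by rewrite nm_distC.
have lim_pt y : exists z : C, forall e : R, 0 < e ->
    exists2 A, F A & forall phi : H, A phi -> nm (phi y - z) <= e.
  apply: complex_cauchy_cvg => e e0.
  have [A FA hA] := diam _ (div1D_gt0 e0 (knorm_ge0 k [:: (1, y)])).
  exists A => // phi psi Aphi Apsi.
  have -> : phi y - psi y = ev (phi - psi) [:: (1, y)] by rewrite gram_evB !ev1.
  rewrite (le_trans (gram_ev_le _ _)) // mulrC.
  apply: le_trans (div1D_le (ltW e0) (knorm_ge0 k [:: (1, y)])).
  by rewrite ler_wpM2l ?knorm_ge0 // -gram_nmE hA.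
have [g gP] := choice lim_pt.
have ev_lim d (e : R) : 0 < e ->
    exists2 A, F A & forall phi : H, A phi -> nm (ev phi d - ev g d) <= e.
  elim: d e => [|p d IHd] e e0.
    exists setT; first exact: filterT.
    by move=> phi _; rewrite /ev !big_nil subrr nm0 ltW.
  have e2 : 0 < e / 2 by rewrite divr_gt0.
  have [A FA hA] := IHd _ e2; have [B FB hB] := gP p.2 _ (div1D_gt0 e2 (nm_ge0 p.1)).
  exists (A `&` B); first exact: filterI.
  move=> phi [/hA Aphi /hB Bphi]; rewrite /ev !big_cons opprD addrACA -mulrBr.
  rewrite (le_trans (nmD _ _)) // (splitr e) lerD // nmM nmJ.
  by apply: le_trans (div1D_le (ltW e2) (nm_ge0 p.1)); rewrite ler_wpM2l ?nm_ge0.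
have unif (e : R) : 0 < e -> exists2 A, F A &
    forall phi : H, A phi -> forall d, nm (ev phi d - ev g d) <= e * knorm k d.
  move=> e0; have [A FA hA] := diam _ e0; exists A => // phi Aphi d.
  apply/ler_addgt0Pr => t t0; have [B FB hB] := ev_lim d _ t0.
  have [psi [Apsi Bpsi]] := filter_ex (filterI FA FB).
  rewrite (le_trans (nm_dist (ev psi d) _ _)) // lerD ?hB //.
  by rewrite -gram_evB (le_trans (gram_ev_le _ _)) // ler_wpM2r ?knorm_ge0 // -gram_nmE hA.
have g_appr : g \in approximable_pred k.
  apply/asboolP => e e0; have e2 : 0 < e / 2 by rewrite divr_gt0.
  have [A FA hA] := unif _ e2; have [phi Aphi] := filter_ex FA.
  have [c hc] := gram_approx phi e2; exists c => d.
  rewrite (le_trans (nm_dist (ev phi d) _ _)) // (splitr e) mulrDl lerD //.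
  by rewrite nm_distC hA.
apply/cvg_ex; exists (GramSpace g_appr); apply/cvgrPdist_le => e e0.
have re0 : 0 < complex.Re e by move: e0; rewrite ltcE => /andP[].
have [A FA hA] := unif _ re0; apply: filterS FA => phi Aphi.
rewrite nmE (ge0_Re (ltW e0)) lecR gram_nmE gram_norm_le ?(ltW re0) // => d.
by rewrite gram_evB nm_distC; apply: hA.
Qed.

HB.instance Definition _ := Uniform_isComplete.Build H gram_complete.

Lemma gram_sqr_normE phi : `|phi| ^+ 2 = gram_inner phi phi.
Proof. by rewrite nmE gram_nmE -rmorphXn /= gram_norm2 -ge0_Re // gram_inner_ge0. Qed.

HB.instance Definition _ := CompleteNormedModule_isHilbert.Build R H gram_sqr_normE.

Definition gram_vec y : H := gram_comb [:: (1, y)].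

Lemma inner_gram_vec phi y : inner phi (gram_vec y) = gram_fun phi y.
Proof. by rewrite -[LHS]/(gram_inner _ _) gram_inner_comb ev1. Qed.

Lemma gram_vecE x y : inner (gram_vec y) (gram_vec x) = k x y.
Proof. by rewrite inner_gram_vec /= /kcomb big_seq1 mulr1. Qed.

Lemma gram_ext phi psi :
  (forall y, inner phi (gram_vec y) = inner psi (gram_vec y)) -> phi = psi.
Proof.
by move=> h; apply/val_inj/funext => y; rewrite /= -!inner_gram_vec.
Qed.

End GramInner.

(** The Kolmogorov decomposition of a kernel. *)
Lemma gram_exists (R : realType) (Y : Type) (k : Y -> Y -> R[i]) : kernel k ->
  exists (H : hilbertType R) (v : Y -> H),
    (forall x y, inner (v y) (v x) = k x y) /\
    (forall g h, (forall y, inner g (v y) = inner h (v y)) -> g = h).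
Proof.
move=> kk; pose k' := PsdKernel kk.
exists (gram_space k' : hilbertType R), (@gram_vec R Y k'); split.
  exact: gram_vecE.
exact: gram_ext.
Qed.

(** * Hilbert tensor products *)

Section Tensor.
Variable R : realType.
Local Notation C := R[i].

(** The Schur product theorem for Gram matrices, by induction on their size.  Let
    [e] be the second component of the first pair.  Splitting the second
    components along [e], the part parallel to [e] contributes [|e|^2] times a
    squared norm, and in the orthogonal part the first pair drops out. *)
Lemma schur_product (H G : hilbertType R) (s : seq (H * G)) :
  0 <= \sum_(p <- s) \sum_(r <- s) inner r.1 p.1 * inner r.2 p.2.
Proof.
have [n] := ubnP (size s); elim: n s => // n IHn [|[h0 e] s] //= sn.
  by rewrite big_nil.
(* If [e = 0] then [l = 0], and the identities below still hold. *)
pose l (g : G) : C := inner g e / inner e e.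
have lE g : inner g e = l g * inner e e.
  have [e0|e0] := eqVneq (inner e e) 0; last by rewrite /l divfK.
  by rewrite e0 mulr0 (inner_eq0 e0) inner0r.
pose t := (h0, e) :: s.
pose t' := [seq (p.1, p.2 - l p.2 *: e) | p <- s].
have le : e - l e *: e = 0.
  have [e0|e0] := eqVneq (inner e e) 0; last by rewrite /l divff // scale1r subrr.
  by rewrite (inner_eq0 e0) scaler0 subrr.
have split_inner g g' : inner g g' =
    inner (g - l g *: e) (g' - l g' *: e) + l g * (l g')^* * inner e e.
  rewrite innerBl !innerBr !innerZl !innerZr (innerC e g') (lE g) (lE g') !rmorphM /=.
  by rewrite -(innerC e e); ring.
have -> : \sum_(p <- t) \sum_(r <- t) inner r.1 p.1 * inner r.2 p.2 =
    \sum_(p <- t') \sum_(r <- t') inner r.1 p.1 * inner r.2 p.2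
    + inner e e * inner (\sum_(p <- t) l p.2 *: p.1) (\sum_(p <- t) l p.2 *: p.1).
  have -> : \sum_(p <- t') \sum_(r <- t') inner r.1 p.1 * inner r.2 p.2 =
    \sum_(p <- t) \sum_(r <- t) inner r.1 p.1 * inner (r.2 - l r.2 *: e) (p.2 - l p.2 *: e).
    rewrite [RHS]big_cons [X in _ = X + _]big1 ?add0r => [|r _]; last first.
      by rewrite /= le inner0r mulr0.
    rewrite /t' big_map; apply: eq_bigr => p _ /=.
    by rewrite big_cons big_map /= le inner0l mulr0 add0r.
  rewrite inner_sumr mulr_sumr -big_split; apply: eq_bigr => p _ /=.
  rewrite inner_suml mulr_sumr -big_split; apply: eq_bigr => r _ /=.
  by rewrite (split_inner r.2 p.2) innerZl innerZr; ring.
rewrite addr_ge0 ?mulr_ge0 ?inner_ge0 //.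
by apply: IHn; rewrite size_map.
Qed.

Lemma total_clspan (H : hilbertType R) (Y : Type) (v : Y -> H) :
  (forall u, (forall y, inner u (v y) = 0) -> u = 0) -> forall h, clspan v h.
Proof.
move=> tot h; have [P [Pin PE _ _ _]] := projection_exists (clspan_closed v).
suff -> : h = P h by [].
apply/eqP; rewrite -subr_eq0; apply/eqP/tot => y.
by rewrite innerC innerBr PE ?subrr ?conjC0 //; exact: clspan_mem.
Qed.

(** The tensor product is the Hilbert space of the kernel
    [<h', h> <g', g>] on [H * G]; bilinearity and density follow from the
    Gram matrix of the elementary tensors. *)
Lemma tensor_exists (H G : hilbertType R) : exists T : hilbert_tensor H G, True.
Proof.
pose k (p q : H * G) : C := inner q.1 p.1 * inner q.2 p.2.
have k_psd : kernel k.
  move=> n x c; have := schur_product [seq (c i *: (x i).1, (x i).2) | i <- enum 'I_n].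
  rewrite big_map big_enum; congr (_ <= _); apply: eq_bigr => i _.
  rewrite big_map big_enum; apply: eq_bigr => j _.
  by rewrite /k /= innerZl innerZr; ring.
have [T [v [vE v_ext]]] := gram_exists k_psd.
have vbil : bilinear_for *:%R *:%R (fun h g => v (h, g)).
  split=> w a u u'; apply: v_ext => -[h g];
  by rewrite innerDl innerZl !vE /k /= innerDl innerZl; ring.
pose f : {bilinear H -> G -> T} := HB.pack (fun h g => v (h, g))
  (bilinear_isBilinear.Build C H G T *:%R *:%R (fun h g => v (h, g)) vbil).
have f_inner h e h' e' : inner (f h e) (f h' e') = inner h h' * inner e e'.
  by rewrite vE.
have f_dense : dense [set t | exists s : seq (H * G), t = \sum_(p <- s) f p.1 p.2].
  move=> O [t Ot] O_open.
  have tv : clspan v t.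
    by apply: total_clspan => u uv; apply: v_ext => y; rewrite uv inner0l.
  have /nbhs_ballP[e /= e0 eO] := open_nbhs_nbhs (conj O_open Ot).
  have re0 : 0 < complex.Re e by move: e0; rewrite ltcE => /andP[].
  have [c tc] := tv _ (divr_gt0 re0 (ltr0n _ 2)).
  exists (comb v c); split.
    apply: eO; rewrite -ball_normE /ball_ /= nmE (ge0_Re (ltW e0)) ltcR (le_lt_trans tc) //.
    by rewrite ltr_pdivrMr // ltr_pMr // ltr1n.
  exists [seq (p.1 *: p.2.1, p.2.2) | p <- c]; rewrite big_map.
  apply: eq_bigr => -[a [h g]] _ /=.
  exact: esym (linearZl_LR f g a h).
by exists (HilbertTensor f_inner f_dense).
Qed.

Lemma tensor_ind (H E : hilbertType R) (T : hilbert_tensor H E) (W : set T) :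
  closed_subspace W -> (forall h e, W (tens T h e)) -> forall t, W t.
Proof.
move=> clW We t; apply: contrapT => Wt; have [_ W_closed] := clW.
have [|u [Wu [s us]]] := @tens_dense _ _ _ T (~` W) _ (closed_openC W_closed).
  by exists t.
by apply: Wu; rewrite us; apply: (subspace_sum clW) => p.
Qed.

Lemma nm_tens (H E : hilbertType R) (T : hilbert_tensor H E) h e :
  nm (tens T h e) = nm h * nm e.
Proof.
apply/eqP; rewrite -(@eqrXn2 _ 2) ?mulr_ge0 ?nm_ge0 // exprMn !nm2E inner_tens.
by rewrite !inner_nm -rmorphM.
Qed.

Section RkhsTensor.
Variables (X : Type) (s : X -> X -> C) (Hs : rkhs s).

Lemma rkhs_kernel_inner x y : inner (rkhs_kernel Hs y) (rkhs_kernel Hs x) = s x y.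
Proof. by rewrite rkhs_reproducing rkhs_kernelE. Qed.

Lemma rkhs_total (f : Hs) : (forall x, inner f (rkhs_kernel Hs x) = 0) -> f = 0.
Proof.
move=> f0; apply: rkhs_fun_inj => x.
by rewrite -!rkhs_reproducing f0 inner0l.
Qed.

(** The value at [x] of an element [t] of the tensor product represents the
    functional [e |-> <s_x (x) e, t>]. *)
Lemma rkhs_tensor_exists (E : hilbertType R) (T : hilbert_tensor Hs E) :
  exists TE : rkhs_tensor Hs E, True.
Proof.
pose s_ x := rkhs_kernel Hs x.
have value t x : exists v : E, forall e, inner v e = inner t (tens T (s_ x) e).
  have M0 : 0 <= nm t * nm (s_ x) by rewrite mulr_ge0 ?nm_ge0.
  have [c|v [vE _ _]] := @moment_problem R E E id (fun e => inner (tens T (s_ x) e) t) _ M0.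
    have -> : \sum_(p <- c) p.1 * inner (tens T (s_ x) p.2) t
        = inner (tens T (s_ x) (comb id c)) t.
      rewrite linear_sumr inner_suml; apply: eq_bigr => p _.
      by rewrite linearZr_LR /= innerZl.
    rewrite (le_trans (inner_le_nm _ _)) // nm_tens.
    by rewrite le_eqVlt; apply/orP; left; apply/eqP; ring.
  by exists v => e; rewrite innerC vE -innerC.
have value' t : exists v : X -> E, forall x e, inner (v x) e = inner t (tens T (s_ x) e).
  by have [v vE] := choice (value t); exists v.
have [F FE] := choice value'.
have F_bounded x : bounded_operator (F ^~ x).
  apply: (@contraction_bounded _ _ _ _ (nm (s_ x))) => [a u v|t].
    by apply: inner_ext => e; rewrite innerDl innerZl !FE innerDl innerZl.
  apply: le_of_sqr; rewrite ?mulr_ge0 ?nm_ge0 // nm2E FE (le_trans (Re_le_nm _)) //.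
  by rewrite (le_trans (inner_le_nm _ _)) // nm_tens mulrA [nm t * _]mulrC.
have F_tens (f : Hs) e x : F (tens T f e) x = rkhs_fun f x *: e.
  apply: inner_ext => e'.
  by rewrite FE inner_tens rkhs_reproducing innerZl.
by exists (RkhsTensor F_bounded F_tens).
Qed.

Variables (E : hilbertType R) (HsE : rkhs_tensor Hs E).

(** [ktens x] is the adjoint of the evaluation at [x]. *)
Definition ktens x (e : E) : HsE := tens HsE (rkhs_kernel Hs x) e.

Lemma ktens_lin x a e e' : ktens x (a *: e + e') = a *: ktens x e + ktens x e'.
Proof. by rewrite /ktens linearDr linearZr_LR. Qed.

Lemma inner_ktens x y e f :
  inner (ktens y f) (ktens x e) = s x y * inner f e.
Proof. by rewrite inner_tens rkhs_kernel_inner. Qed.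

Lemma tensor_fun_inner (t : HsE) x e : inner (tensor_fun t x) e = inner t (ktens x e).
Proof.
have bnd := @tensor_fun_bounded _ _ _ _ _ HsE x.
apply: (tensor_ind (closed_inner_eq e (ktens x e) bnd)) => h f /=.
by rewrite tensor_fun_tens innerZl inner_tens rkhs_reproducing.
Qed.

(** Elements of [H_s (x) E] are determined by their values: for fixed [e] the
    functional [h |-> <h (x) e, t>] is represented in [H_s]. *)
Lemma ktens_total (t : HsE) : (forall x e, inner t (ktens x e) = 0) -> t = 0.
Proof.
move=> t0; have tens0 h e : inner (tens HsE h e) t = 0.
  have Tlin : linear (fun h => tens HsE h e).
    by move=> a u v; rewrite linearDl /= linearZl_LR.
  have [|T' [T'E _ _]] := adjoint_exists (nm_ge0 e) Tlin.
    by move=> u; rewrite nm_tens mulrC.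
  rewrite T'E (_ : T' t = 0) ?inner0r //; apply: rkhs_total => x.
  by rewrite innerC -T'E innerC conjCK t0.
have bid : bounded_operator (id : HsE -> HsE) by split=> // x; exact: cvg_id.
apply: inner_eq0; rewrite -(inner0r t).
have /= ind := tensor_ind (closed_inner_eq t 0 bid).
by apply: ind => h e; rewrite tens0 inner0r.
Qed.

Lemma tensor_fun_inj (t t' : HsE) : tensor_fun t =1 tensor_fun t' -> t = t'.
Proof.
move=> tt'; apply/eqP; rewrite -subr_eq0; apply/eqP/ktens_total => x e.
by rewrite innerBl -!tensor_fun_inner tt' subrr.
Qed.

Lemma ktens_clspan (t : HsE) : clspan (fun p : X * E => ktens p.1 p.2) t.
Proof. by apply: total_clspan => u u0; apply: ktens_total => x e; exact: (u0 (x, e)). Qed.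

End RkhsTensor.
End Tensor.

(** * Multipliers *)

Section Multipliers.
Variables (R : realType) (X : Type) (l k : X -> X -> R[i]).
Variables (Hl : rkhs l) (Hk : rkhs k) (F E : hilbertType R).
Variables (HlF : rkhs_tensor Hl F) (HkE : rkhs_tensor Hk E).
Implicit Types Phi : X -> F -> E.

Lemma mulopE Phi : multiplier HlF HkE Phi ->
  forall f x, tensor_fun (mulop HlF HkE Phi f) x = Phi x (tensor_fun f x).
Proof.
move=> [_ mul] f.
by rewrite /mulop; case: xgetP => [g _ //|nog]; have [g /nog] := mul f.
Qed.

Lemma mulop_uniq Phi f g : (forall x, tensor_fun g x = Phi x (tensor_fun f x)) ->
  mulop HlF HkE Phi f = g.
Proof.
move=> gE; apply: tensor_fun_inj => x.
by rewrite /mulop; case: xgetP => [h _ /= ->|/(_ g)/=/(_ gE)//]; rewrite gE.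
Qed.

End Multipliers.

(** * Invariant subspaces for a complete Nevanlinna-Pick kernel *)

Section CompleteNP.
Variables (R : realType) (X : Type) (s : X -> X -> R[i]) (Hs : rkhs s).
Local Notation C := R[i].
Hypothesis s_neq0 : forall x y, s x y != 0.
Variables (B : hilbertType R) (b : X -> B).
Hypothesis bE : forall x y, inner (b y) (b x) = 1 - (s x y)^-1.

(** The row of multiplications by the functions [x |-> <e, b x>], [e] in [B], is
    treated once for [H = H_s] and once for [H = H_s (x) F]; in both cases the
    Gram matrix of the kernel functions [t], divided by [s], is positive. *)

Section RowContraction.
Variables (H : hilbertType R) (T : hilbert_tensor H B) (Y : Type) (t : Y -> H) (x : Y -> X).
Hypothesis gram_div_psd : forall c : seq (C * Y), 0 <= \sum_(p <- c) \sum_(q <- c)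
  p.1 * q.1^* * (inner (t p.2) (t q.2) / s (x q.2) (x p.2)).

(** The adjoint of the row sends [t y] to [t y (x) b (x y)], and
    [<b, b> = 1 - 1/s] turns the loss of squared norm into the positive form of
    the hypothesis. *)
Lemma row_adjoint_contraction c :
  nm (comb (fun y => tens T (t y) (b (x y))) c) <= nm (comb t c).
Proof.
rewrite -(@ler_pXn2r _ 2) ?nnegrE ?nm_ge0 // -subr_ge0.
suff -> : nm (comb t c) ^+ 2 - nm (comb (fun y => tens T (t y) (b (x y))) c) ^+ 2 =
    complex.Re (\sum_(p <- c) \sum_(q <- c)
      p.1 * q.1^* * (inner (t p.2) (t q.2) / s (x q.2) (x p.2))) by apply: Re_ge0.
rewrite !nm2E -ReN -ReD; congr complex.Re.
rewrite !inner_suml -sumrB; apply: eq_bigr => p _.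
rewrite !inner_sumr -sumrB; apply: eq_bigr => q _.
by rewrite !innerZl !innerZr inner_tens bE; ring.
Qed.

Lemma row_operator (w : T) : exists z,
  (forall y, inner z (t y) = inner w (tens T (t y) (b (x y)))) /\ nm z <= nm w.
Proof.
have [c|z [zE zw _]] := @moment_problem R H Y t
    (fun y => inner (tens T (t y) (b (x y))) w) _ (nm_ge0 w).
  apply: le_trans (ler_wpM2l (nm_ge0 w) (row_adjoint_contraction c)).
  rewrite mulrC; apply: le_trans (inner_le_nm _ _).
  rewrite inner_suml le_eqVlt; apply/orP; left; apply/eqP; congr nm.
  by apply: eq_bigr => p _; rewrite innerZl.
by exists z; split=> // y; rewrite innerC zE -innerC.
Qed.

End RowContraction.

Lemma cnp_Mult y : Mult Hs (fun x => 1 - (s x y)^-1).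
Proof.
move=> f; have [T _] := tensor_exists Hs B.
have [c|g [gE _]] := @row_operator _ T X (rkhs_kernel Hs) id _ (tens T f (b y)).
  have -> : \sum_(p <- c) \sum_(q <- c) p.1 * q.1^* *
      (inner (rkhs_kernel Hs p.2) (rkhs_kernel Hs q.2) / s q.2 p.2)
      = (\sum_(p <- c) p.1) * (\sum_(p <- c) p.1)^*.
    rewrite mulr_suml; apply: eq_bigr => p _; rewrite rmorph_sum mulr_sumr.
    by apply: eq_bigr => q _; rewrite rkhs_kernel_inner divff // mulr1.
  exact: mul_conjC_ge0.
by exists g => x; rewrite -!rkhs_reproducing gE inner_tens bE mulrC.
Qed.

Section Invariant.
Variables (F : hilbertType R) (HsF : rkhs_tensor Hs F) (L : set HsF).
Hypothesis L_closed : closed_subspace L.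
Hypothesis L_inv : forall phi u v, Mult Hs phi -> L u ->
  (forall x, tensor_fun v x = phi x *: tensor_fun u x) -> L v.

Lemma row_operator_tensor (T : hilbert_tensor HsF B) (w : T) : exists z : HsF,
  (forall x e, inner z (ktens HsF x e) = inner w (tens T (ktens HsF x e) (b x)))
  /\ nm z <= nm w.
Proof.
have [c|z [zE zw]] := @row_operator _ T (X * F) (fun p => ktens HsF p.1 p.2) fst _ w.
  have -> : \sum_(p <- c) \sum_(q <- c) p.1 * q.1^* *
      (inner (ktens HsF p.2.1 p.2.2) (ktens HsF q.2.1 q.2.2) / s q.2.1 p.2.1)
      = inner (comb snd c) (comb snd c).
    rewrite inner_suml; apply: eq_bigr => p _; rewrite inner_sumr.
    apply: eq_bigr => q _; rewrite innerZl innerZr inner_ktens.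
    by rewrite [s _ _ * _ / _]mulrAC divff // mul1r mulrA.
  exact: inner_ge0.
by exists z; split=> // x e; rewrite (zE (x, e)).
Qed.

Variable P : HsF -> HsF.
Hypothesis P_in : forall h, L (P h).
Hypothesis P_inner : forall w h, L w -> inner w (P h) = inner w h.

Lemma projection_sym g h : inner (P g) h = inner g (P h).
Proof. by rewrite -P_inner // innerC P_inner // -innerC. Qed.

(** Invariance of [L] gives the inequality [|w| <= |P t|] between
    [w = sum_i c_i (P t_i (x) b_{x_i})] and [P t = sum_i c_i P t_i] ([v]
    below); the difference of the squares is the quadratic form. *)
Lemma invariant_kernel_div_psd : kernel (fun p q : X * F =>
  inner (P (ktens HsF q.1 q.2)) (ktens HsF p.1 p.2) / s p.1 q.1).
Proof.
move=> n x c; have [T _] := tensor_exists HsF B.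
pose t i := ktens HsF (x i).1 (x i).2; pose y i := (x i).1.
pose w := \sum_i c i *: tens T (P (t i)) (b (y i)).
pose v := \sum_i c i *: P (t i).
have [z [zE zw]] := row_operator_tensor w.
(* The image [z] of [w] under the row is the combination of the products of the
   [P (t i)] by multipliers of [H_s]. *)
have Lz : L z.
  have zi i : exists z, L z /\ forall x e, inner z (ktens HsF x e) =
      inner (tens T (P (t i)) (b (y i))) (tens T (ktens HsF x e) (b x)).
    have [z' [z'E _]] := row_operator_tensor (tens T (P (t i)) (b (y i))).
    exists z'; split=> //; apply: (L_inv (cnp_Mult (y i)) (P_in (t i))) => x'.
    apply: inner_ext => e.
    by rewrite tensor_fun_inner z'E inner_tens bE innerZl tensor_fun_inner mulrC.
  have [zs zsP] := choice zi.
  have -> : z = \sum_i c i *: zs i.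
    apply/eqP; rewrite -subr_eq0; apply/eqP/ktens_total => x' e.
    rewrite innerBl zE !inner_suml -sumrB big1 // => i _.
    by have [_ zsE] := zsP i; rewrite !innerZl zsE subrr.
  apply: (subspace_sum L_closed) => i; apply: (subspaceZ L_closed).
  by have [] := zsP i.
have wwE : inner w w = inner z v.
  rewrite !inner_sumr; apply: eq_bigr => j _.
  rewrite !innerZr P_inner // zE; congr (_ * _); rewrite !inner_suml.
  apply: eq_bigr => i _; rewrite !innerZl !inner_tens.
  by rewrite P_inner.
have wv : nm w <= nm v.
  apply: le_of_sqr; rewrite ?nm_ge0 // nm2E wwE (le_trans (Re_le_nm _)) //.
  by rewrite (le_trans (inner_le_nm _ _)) // mulrC ler_wpM2l ?nm_ge0.
have -> : \sum_(i < n) \sum_(j < n) (c i)^* *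
    (inner (P (ktens HsF (x j).1 (x j).2)) (ktens HsF (x i).1 (x i).2)
       / s (x i).1 (x j).1) * c j
    = inner v v - inner w w.
  rewrite !inner_sumr -sumrB; apply: eq_bigr => i _.
  rewrite !inner_suml -sumrB; apply: eq_bigr => j _.
  by rewrite !innerZl !innerZr inner_tens bE !P_inner // -/(t i) -/(t j) /y; ring.
rewrite !inner_nm -rmorphB ler0c subr_ge0.
by rewrite ler_pXn2r ?nnegrE ?nm_ge0.
Qed.

End Invariant.
End CompleteNP.

(** The vector-valued Beurling-Lax theorem of McCullough and Trent.  The adjoint
    [U'] of the multiplication operator is part of the conclusion because
    orthogonality to kernels is transported through it. *)
Lemma invariant_subspace_multiplier (R : realType) (X : Type)
    (s : X -> X -> R[i]) (Hs : rkhs s)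
    (F : hilbertType R) (HsF : rkhs_tensor Hs F) (L : set HsF) :
    complete_NP s -> closed_subspace L ->
    (forall phi u v, Mult Hs phi -> L u ->
       (forall x, tensor_fun v x = phi x *: tensor_fun u x) -> L v) ->
  exists (G : hilbertType R) (HsG : rkhs_tensor Hs G) (Gamma : X -> G -> F) (U' : HsF -> HsG),
    [/\ partially_isometric_multiplier HsG HsF Gamma,
        forall h g, inner (mulop HsG HsF Gamma h) g = inner h (U' g),
        forall h, L (mulop HsG HsF Gamma h)
      & forall g, L g -> mulop HsG HsF Gamma (U' g) = g].
Proof.
move=> [_ _ s_neq0 cnp] L_closed L_inv.
have [B [b [bE _]]] := gram_exists cnp.
have [P [P_in P_inner P_id P_lin P_le]] := projection_exists L_closed.
have [G [v [vE v_ext]]] := gram_exists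
  (invariant_kernel_div_psd s_neq0 bE L_closed L_inv P_in P_inner).
have Psym := projection_sym P_in P_inner.
have vs p q : s p.1 q.1 * inner (v q) (v p) =
    inner (P (ktens HsF q.1 q.2)) (P (ktens HsF p.1 p.2)).
  by rewrite vE mulrC divfK // P_inner.
have v_lin x : linear (fun e => v (x, e)).
  move=> a e e'; apply: v_ext => p.
  by rewrite innerDl innerZl !vE /= ktens_lin P_lin innerDl innerZl mulrDl mulrA.
have v_le x e : nm (v (x, e)) <= 1 * nm e.
  rewrite mul1r -(@ler_pXn2r _ 2) ?nnegrE ?nm_ge0 //.
  have := vs (x, e) (x, e); rewrite /= -(rkhs_kernel_inner Hs) !inner_nm -rmorphM => -[vsx].
  have s0 : 0 < nm (rkhs_kernel Hs x) ^+ 2.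
    rewrite lt_def sqr_ge0 andbT; apply: contraNneq (s_neq0 x x) => s0.
    by rewrite -(rkhs_kernel_inner Hs) inner_nm s0.
  rewrite -(ler_pM2l s0) vsx -exprMn -(nm_tens HsF).
  by rewrite ler_pXn2r ?nnegrE ?nm_ge0 // -[leRHS]mul1r P_le.
(* [v (x, .)] plays the part of the adjoint of [Gamma x]. *)
have Gamma_ex x : exists D : G -> F, [/\ forall e g, inner (v (x, e)) g = inner e (D g),
    linear D & forall g, nm (D g) <= 1 * nm g].
  exact: adjoint_exists.
have [Gamma GammaP] := choice Gamma_ex.
have [T _] := tensor_exists Hs G; have [HsG _] := rkhs_tensor_exists T.
(* [<a q, a p> = s (K/s) = K], which is the Gram matrix of the [bb p]. *)
pose a (p : X * F) := ktens HsG p.1 (v p).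
pose bb (p : X * F) := P (ktens HsF p.1 p.2).
have [y z|U [U' [U_pi UU' UE U_in U'K]]] := @gram_partial_isometry R _ _ _ a bb.
  by rewrite inner_ktens vs.
have bbL : clspan bb `<=` L by apply: clspan_sub => // p; exact: P_in.
have Lbb g : L g -> clspan bb g.
  move=> Lg; rewrite -(P_id g Lg).
  have := preimage_closed_subspace (contraction_bounded P_lin P_le) (clspan_closed bb).
  move=> cl; apply: (clspan_sub cl) (ktens_clspan g) => p /=.
  exact: (clspan_mem bb p).
have Ufun h x : tensor_fun (U h) x = Gamma x (tensor_fun h x).
  apply: inner_ext => e; have [Gx _ _] := GammaP x.
  have /bbL LU := U_in h.
  rewrite tensor_fun_inner -P_inner // (UE h (x, e)) -tensor_fun_inner.
  by rewrite innerC Gx -innerC.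
have mulU h : mulop HsG HsF Gamma h = U h by apply: mulop_uniq.
exists G, HsG, Gamma, U'; split.
- split; last by rewrite (_ : mulop HsG HsF Gamma = U) //; apply/funext.
  split=> [x|h]; last by exists (U h).
  by have [_ lin le] := GammaP x; exact: contraction_bounded lin le.
- by move=> h g; rewrite mulU.
- by move=> h; rewrite mulU; apply/bbL/U_in.
- by move=> g Lg; rewrite mulU U'K //; apply: Lbb.
Qed.

(** * The preimage of an invariant subspace under a multiplier *)

Theorem theorem1p4 (R : realType) (X : Type) (k s : X -> X -> R[i])
    (k_ker : kernel k) (s_cnp : complete_NP s)
    (ks_ker : kernel (fun x y => k x y / s x y))
    (Hk : rkhs k) (Hs : rkhs s) (E F : hilbertType R)
    (HkE : rkhs_tensor Hk E) (HsF : rkhs_tensor Hs F)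
    (N M : set HkE)
    (N_closed : closed_subspace N) (M_closed : closed_subspace M)
    (N_neq0 : N <> [set 0]) (M_neq0 : M <> [set 0]) (NM : N `<=` M)
    (Phi : X -> F -> E)
    (Phi_pisom : partially_isometric_multiplier HsF HkE Phi)
    (M_range : M = range (mulop HsF HkE Phi))
    (N_inv : Mult_invariant Hs N) :
  exists (G : hilbertType R) (HsG : rkhs_tensor Hs G) (Gamma : X -> G -> F),
    [/\ partially_isometric_multiplier HsG HsF Gamma,
        partially_isometric_multiplier HsG HkE (fun x => Phi x \o Gamma x)
      & N = range (mulop HsG HkE (fun x => Phi x \o Gamma x))].
Proof.
have [Phi_mul [T_bounded T_isom]] := Phi_pisom.
set T := mulop HsF HkE Phi in T_bounded T_isom M_range.
have TE : forall f x, tensor_fun (T f) x = Phi x (tensor_fun f x) := mulopE Phi_mul.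
pose L : set HsF := [set u | N (T u)].
have L_closed : closed_subspace L by exact: preimage_closed_subspace.
have L_inv phi u v : Mult Hs phi -> L u ->
    (forall x, tensor_fun v x = phi x *: tensor_fun u x) -> L v.
  move=> phi_mult Lu vE; apply: (N_inv phi phi_mult); exists (T u) => //.
  apply: mulop_uniq => x; have [Phi_bounded _] := Phi_mul.
  by have [Phi_lin _] := Phi_bounded x; rewrite !TE vE linear_opZ.
have [G [HsG [Gamma [U' [Gamma_pi UU' U_in U'K]]]]] :=
  invariant_subspace_multiplier s_cnp L_closed L_inv.
have [Gamma_mul [U_bounded U_isom]] := Gamma_pi.
set U := mulop HsG HsF Gamma in UU' U_in U'K U_bounded U_isom.
have UE : forall f x, tensor_fun (U f) x = Gamma x (tensor_fun f x) := mulopE Gamma_mul.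
have TUE f x : tensor_fun (T (U f)) x = (Phi x \o Gamma x) (tensor_fun f x).
  by rewrite TE UE.
have mulTU : mulop HsG HkE (fun x => Phi x \o Gamma x) = T \o U.
  by apply/funext => f; apply: mulop_uniq => x; exact: TUE.
have comp_bounded (H1 H2 H3 : hilbertType R) (f : H2 -> H3) (g : H1 -> H2) :
    bounded_operator f -> bounded_operator g -> bounded_operator (f \o g).
  move=> [flin fcont] [glin gcont]; split=> [a u v|u] /=; first by rewrite glin flin.
  exact: (cvg_comp _ _ (gcont u) (fcont (g u))).
have [T_lin _] := T_bounded.
exists G, HsG, Gamma; split=> //.
  split; first split=> [x|f].
  - by apply: comp_bounded; [have [+ _] := Phi_mul|have [+ _] := Gamma_mul].
  - by exists (T (U f)).
  rewrite mulTU; split=> [|h h_orth]; first exact: comp_bounded.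
  rewrite /= -U_isom => [|g Ug]; last first.
    by apply: h_orth; rewrite /= Ug linear_op0.
  apply: T_isom => g Tg.
  have Lg : L g by rewrite /L /= Tg; exact: subspace0.
  by rewrite UU' h_orth //=; rewrite U'K.
rewrite mulTU; apply/seteqP; split=> [w Nw|_ [f _ <-]]; last exact: U_in.
have := NM w Nw; rewrite M_range => -[u _ uw].
by exists (U' u) => //=; rewrite U'K //= /L /= uw.
Qed.
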